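(* Let $\Omega\subset\mathbb{R}^n$ be an open connected set, let $1<p<\infty$ and $\sigma>1$, and let $Q$ be a measurable function on $\Omega$ whose values are (a.e.) symmetric positive semi-definite $n\times n$ matrices, with $Q\in L^\infty(\Omega)$. Let $r_1:\Omega\to(0,\infty)$ be a positive continuous function, and let $B(y,r)$ denote Euclidean balls. Suppose: (1) (local Sobolev property of order $p$ with gain $\sigma$) there is a constant $C_0>0$ such that for all $y\in\Omega$, $0<r<r_1(y)$ and $f\in Lip_0(B(y,r))$, $$\Big(\frac{1}{|B(y,r)|}\int_{B(y,r)}|f|^{p\sigma}\,dx\Big)^{\frac{1}{p\sigma}}\le C_0 r\Big(\frac{1}{|B(y,r)|}\int_{B(y,r)}|\sqrt{Q}\nabla f|^p\,dx\Big)^{\frac1p}+C_0\Big(\frac{1}{|B(y,r)|}\int_{B(y,r)}|f|^p\,dx\Big)^{\frac1p};$$ (2) (local Poincaré inequality) there are constants $C>0$ and $\beta\ge1$ such that for all $y\in\Omega$, all $r$ with $0<\beta r<r_1(y)$, and all $f\in Lip_0(\Omega)$, $$\Big(\frac{1}{|B(y,r)|}\int_{B(y,r)}|f-f_{B(y,r)}|^{p}\,dx\Big)^{\frac{1}{p}}\le C r\Big(\frac{1}{|B(y,\beta r)|}\int_{B(y,\beta r)}|\sqrt{Q}\nabla f|^p\,dx\Big)^{\frac1p}.$$ Then for every open set $\Theta\Subset\Omega$ there exists a constant $C(\Theta)$ such that for all $f\in Lip_0(\Theta)$, $$\Big(\int_\Theta|f|^{p\sigma}\,dx\Big)^{\frac{1}{p\sigma}}\le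 C(\Theta)\Big(\int_\Theta|\sqrt{Q}\nabla f|^p\,dx\Big)^{\frac1p}.$$
   Context: $Q\in L^\infty(\Omega)$ means $|Q|_{\mathrm{op}}\in L^\infty(\Omega)$, where $|Q(x)|_{\mathrm{op}}=\sup_{|\xi|=1}|Q(x)\xi|$. $\sqrt{Q}$ is the positive semi-definite square root. Euclidean balls are taken in $\Omega$: $B(y,r)=\{x\in\Omega:|x-y|<r\}$. $f_{B}=\frac{1}{|B|}\int_{B}f\,dx$. For an open set $U$, $\Theta\Subset U$ means that $\Theta$ is bounded and $\overline{\Theta}\subset U$; $Lip_0(U)$ is the set of all Lipschitz functions $f$ with $\operatorname{supp}(f)\Subset U$. $\nabla f$ is the a.e. defined gradient. *)

(* Defs.v *)
From HB Require Import structures.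
From mathcomp Require Import all_boot all_order all_algebra.
From mathcomp Require Import all_classical all_reals all_analysis.

Set Implicit Arguments.
Unset Strict Implicit.
Unset Printing Implicit Defensive.

Import Order.TTheory GRing.Theory Num.Theory.
Import numFieldNormedType.Exports.

Local Open Scope classical_set_scope.
Local Open Scope ring_scope.

(** Points of R^n are row vectors ['rV[R]_n.+1], so the dimension [n.+1] is
    positive; gradients and the vectors acted upon by matrices are column
    vectors. *)

(** ** Lebesgue measure on R^n: the outer measure given by countable covers by
    open boxes, restricted to its Caratheodory measurable sets. *)

Section lebesgue_outer.
Context (R : realType) (n : nat).
Local Notation V := 'rV[R]_n.+1.

Definition open_box (c : V * V) : set V :=
  [set x | forall i, c.1 0 i < x 0 i < c.2 0 i].

Definition box_volume (c : V * V) : R := \prod_i (c.2 0 i - c.1 0 i).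

Definition box_cover (A : set V) : set (nat -> V * V) :=
  [set c : nat -> V * V | (forall k i, (c k).1 0 i <= (c k).2 0 i) /\
           A `<=` \bigcup_k open_box (c k)].

Definition lebesgue_outer (A : set V) : \bar R :=
  ereal_inf
    [set (\sum_(k <oo) (box_volume (c k))%:E)%E | c in box_cover A].

Local Open Scope ereal_scope.

Lemma box_volume_ge0 (A : set V) (c : nat -> V * V) k :
  box_cover A c -> 0 <= (box_volume (c k))%:E.
Proof.
by move=> [c0 _]; rewrite lee_fin prodr_ge0// => i _; rewrite subr_ge0.
Qed.

Lemma lebesgue_outer_ge0 A : 0 <= lebesgue_outer A.
Proof.
apply: le_ereal_inf_tmp => _ [c Ac <-].
by apply: nneseries_ge0 => k _ _; exact: box_volume_ge0 Ac.
Qed.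

Lemma le_lebesgue_outer : {homo lebesgue_outer : A B / A `<=` B >-> A <= B}.
Proof.
move=> A B AB; apply/ereal_inf_le_tmp => _ [c [c0 Bc] <-].
by exists c => //; split => //; exact: subset_trans AB Bc.
Qed.

Lemma lebesgue_outer0 : lebesgue_outer set0 = 0.
Proof.
apply/eqP; rewrite eq_le lebesgue_outer_ge0 andbT.
apply: ereal_inf_lbound; exists (fun=> (0%R, 0%R)).
  by split=> [k i|]; [rewrite lexx|exact: sub0set].
apply: eseries0 => k _ _.
by rewrite /box_volume big_ord_recl/= subrr mul0r.
Qed.

Lemma lebesgue_outer_sigma_subadditive : sigma_subadditive lebesgue_outer.
Proof.
move=> A; have [[i ioo]|] := pselect (exists i, lebesgue_outer (A i) = +oo).
  rewrite (eseries_pinfty _ _ ioo) ?leey// => n0 _.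
  by rewrite -ltNye (lt_le_trans _ (lebesgue_outer_ge0 _)).
rewrite -forallNE => Aoo.
apply/lee_addgt0Pr => _/posnumP[e].
rewrite (le_trans _ (epsilon_trick _ _ _))//; last first.
  by move=> k; exact: lebesgue_outer_ge0.
pose P k (c : nat -> V * V) := box_cover (A k) c /\
  \sum_(j <oo) (box_volume (c j))%:E <=
    lebesgue_outer (A k) + (e%:num / (2 ^ k.+1)%:R)%:E.
have [G PG] : {G : nat -> nat -> V * V & forall k, P k (G k)}.
  apply: (@choice _ _ P) => k; rewrite /P /lebesgue_outer.
  set S := (X in ereal_inf X); move infS : (ereal_inf S) => iS.
  case: iS infS => [r Sr|Soo|Soo].
  - have en1 : (0 < e%:num / (2 ^ k.+1)%:R)%R by [].
    have /(lb_ereal_inf_adherent en1) : ereal_inf S \is a fin_num by rewrite Sr.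
    move=> [_ [c Ac <-] cS].
    by exists c; split => //; rewrite -Sr; exact/ltW.
  - by have := Aoo k; rewrite /lebesgue_outer Soo.
  - by have := lebesgue_outer_ge0 (A k); rewrite /lebesgue_outer -/S Soo.
pose vol (kj : nat * nat) : \bar R := (box_volume (uncurry G kj))%:E.
have vol_ge0 kj : 0 <= vol kj.
  by case: kj => k j; exact: (box_volume_ge0 j (PG k).1).
apply: (@le_trans _ _ (\esum_(kj in [set: nat * nat]) vol kj)).
  have /card_esym/ppcard_eqP[f] := card_nat2.
  apply: ereal_inf_lbound; exists (uncurry G \o f).
    split=> [k i|t [i _ /(PG i).1.2[j _ Gt]]].
      by move=> /=; case: (f k) => a b /=; exact: (PG a).1.1.
    by exists (f^-1%FUN (i, j)) => //=; rewrite invK ?inE.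
  rewrite -(esum_pred_image vol _ xpredT) ?[fun=> _]set_true//.
  by rewrite image_eq.
rewrite (_ : esum _ _ = \sum_(i <oo) \sum_(j <oo) vol (i, j)); last first.
  pose J : nat -> set (nat * nat) := fun i => [set (i, j) | j in setT].
  rewrite (_ : setT = \bigcup_k J k); last first.
    by rewrite predeqE => -[a b]; split => // _; exists a => //; exists b.
  rewrite esum_bigcupT /=; last 2 first.
    - apply/trivIsetP => i j _ _ ij.
      rewrite predeqE => -[n0 m] /=; split => //= -[] [_] _ [<-{n0} _].
      by move=> [m' _] [] /esym/eqP; rewrite (negbTE ij).
    - by move=> kj.
  rewrite -(image_id [set: nat]) -fun_true esum_pred_image//; last first.
    by move=> k _; exact: esum_ge0.
  apply: eq_eseriesr => /= j _.
  rewrite -(esum_pred_image vol (pair j) predT)//=; last first.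
    by move=> ? ? _ _; exact: (@can_inj _ _ _ snd).
  by congr esum; rewrite predeqE => -[a b]; split; move=> [i _ <-]; exists i.
apply: lee_lim.
- by apply: is_cvg_nneseries => k _ _; apply: nneseries_ge0.
- apply: is_cvg_nneseries => k _ _.
  by apply: adde_ge0 => //; exact: lebesgue_outer_ge0.
- by near=> k; apply: lee_sum => i _; exact: (PG i).2.
Unshelve. all: by end_near. Qed.

HB.instance Definition _ := isOuterMeasure.Build R V lebesgue_outer
  lebesgue_outer0 lebesgue_outer_ge0 le_lebesgue_outer
  lebesgue_outer_sigma_subadditive.

HB.instance Definition _ := @isMeasurable.Build
  (caratheodory_display lebesgue_outer) V lebesgue_outer.-caratheodory
  (caratheodory_measurable_set0 lebesgue_outer)
  (@caratheodory_measurable_setC _ _ lebesgue_outer)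
  (@caratheodory_measurable_bigcup _ _ lebesgue_outer).

Definition lebesgueRn (A : set V) : \bar R := lebesgue_outer A.

HB.instance Definition _ := isMeasure.Build _ V R lebesgueRn
  (caratheodory_measure0 lebesgue_outer)
  (@caratheodory_measure_ge0 _ _ lebesgue_outer)
  (@caratheodory_measure_sigma_additive _ _ lebesgue_outer).

End lebesgue_outer.
Arguments lebesgueRn : clear implicits.

Section linear_algebra.
Context (R : realType).

(** Euclidean norm of a row or column vector; the library norm [`|v|] on
    matrices is the max norm. *)
Definition enorm (k l : nat) (v : 'M[R]_(k, l)) : R :=
  Num.sqrt (\sum_i \sum_j v i j ^+ 2).

Definition opnorm (n : nat) (A : 'M[R]_n) : R :=
  sup [set enorm (A *m xi) | xi in [set xi : 'cV[R]_n | enorm xi = 1]].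

Definition sym_psd (n : nat) (A : 'M[R]_n) : Prop :=
  A^T = A /\ forall v : 'cV[R]_n, 0 <= (v^T *m A *m v) 0 0.

(** The positive semi-definite square root (0 where there is none). *)
Definition sqrtmx (n : nat) (A : 'M[R]_n) : 'M[R]_n :=
  xget 0 [set S | sym_psd S /\ S *m S = A].

End linear_algebra.

Section analysis.
Context (R : realType) (n : nat).
Local Notation V := 'rV[R]_n.+1.
Local Notation mu := (lebesgueRn R n).
Implicit Types (Omega U A : set V) (f g : V -> R) (Q : V -> 'M[R]_n.+1).

(** [0] at the points where [f] is not differentiable, a null set when [f] is
    Lipschitz. *)
Definition gradient f (x : V) : 'cV[R]_n.+1 :=
  if `[< differentiable f x >] then \col_i 'D_(delta_mx 0 i) f x else 0.

Definition compactly_contained A U : Prop :=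
  bounded_set A /\ closure A `<=` U.

(** Functions on [U] with support compactly contained in [U] are identified
    with their extensions by 0 to the whole space; being Lipschitz does not
    depend on the choice between the Euclidean norm and the max norm. *)
Definition Lip0 U : set (V -> R) :=
  [set f | lipschitz f /\
           compactly_contained (closure [set x | f x != 0]) U].

Definition eball Omega (y : V) (r : R) : set V :=
  [set x | Omega x /\ enorm (x - y) < r].

Definition mean A f : R :=
  (fine (mu A))^-1 * \int[mu]_(x in A) f x.

Definition Lpnorm A (q : R) g : \bar R :=
  ((\int[mu]_(x in A) (`|g x| `^ q)%:E) `^ q^-1)%E.

Definition Lpmean A (q : R) g : \bar R :=
  (((fine (mu A))^-1%:E * \int[mu]_(x in A) (`|g x| `^ q)%:E) `^ q^-1)%E.

Definition Qgrad Q f (x : V) : R := enorm (sqrtmx (Q x) *m gradient f x).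

Definition measurable_mx Omega Q : Prop :=
  forall i j, measurable_fun Omega (fun x => Q x i j).

Definition ae_sym_psd Omega Q : Prop :=
  {ae mu, forall x, Omega x -> sym_psd (Q x)}.

Definition Linfty_mx Omega Q : Prop :=
  finite_norm mu +oo%E ((fun x => opnorm (Q x)) \_ Omega).

Definition local_sobolev Omega Q (r1 : V -> R) (p sigma : R) : Prop :=
  exists2 C0 : R, 0 < C0 &
  forall (y : V) (r : R) f, Omega y -> 0 < r < r1 y ->
    Lip0 (eball Omega y r) f ->
    (Lpmean (eball Omega y r) (p * sigma) f <=
     (C0 * r)%:E * Lpmean (eball Omega y r) p (Qgrad Q f) +
     C0%:E * Lpmean (eball Omega y r) p f)%E.

Definition local_poincare Omega Q (r1 : V -> R) (p : R) : Prop :=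
  exists C beta : R, [/\ 0 < C, 1 <= beta &
  forall (y : V) (r : R) f, Omega y -> 0 < beta * r < r1 y ->
    Lip0 Omega f ->
    (Lpmean (eball Omega y r) p (fun x => f x - mean (eball Omega y r) f)%R <=
     (C * r)%:E * Lpmean (eball Omega y (beta * r)) p (Qgrad Q f))%E].

End analysis.

(* Main.v *)
Require Import Defs.
From mathcomp Require Import all_boot all_order all_algebra.
From mathcomp Require Import all_classical all_reals all_analysis.
From mathcomp Require finmap.
From mathcomp Require Import measurable_realfun ess_sup_inf ring lra.
Import Order.TTheory GRing.Theory Num.Theory.
Import numFieldNormedType.Exports.
Set Implicit Arguments.
Unset Strict Implicit.
Unset Printing Implicit Defensive.
Local Open Scope classical_set_scope.
Local Open Scope ring_scope.

(** Let E(f) be the integral of |sqrt(Q) grad f|^p over Theta.  The points of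
    Omega having a neighbourhood U on which the integral of |f|^p is at most
    K E(f) for all f in Lip_0(Theta) form a set which is open, and closed in
    Omega: by the Poincare inequality on a ball B, a bound on a small open
    W in B controls the mean of f over B, hence f on B.  This set contains
    Omega \ closure(Theta), which is nonempty, so it is all of Omega.
    Applying the Sobolev inequality to f times a cutoff then bounds the
    integral of |f|^(p sigma) near each point by K' E(f)^sigma, and finitely
    many such neighbourhoods cover the closure of Theta.

    The integral of a nonnegative function is a supremum over the simple
    functions below it, so it makes sense, and is monotone, without
    measurability; it is also additive up to <= when one summand is
    measurable.  This is how the integrals of sqrt(Q) grad f are handled, whose
    measurability is not established. *)

(** * Integrals of nonmeasurable nonnegative functions *)

Section nonmeasurable_integrands.
Context d (T : measurableType d) (R : realType) (mu : {measure set T -> \bar R}).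
Implicit Types (D : set T) (f g : T -> \bar R).
Local Open Scope ereal_scope.
Import HBNNSimple.

(** A simple function below [f] extended by 0 off [D1] is also below [g] extended by 0 off [D2], so
    the supremum defining the left integral runs over fewer functions. *)
Lemma ge0_le_integral_subset D1 D2 f g : D1 `<=` D2 ->
  (forall x, D1 x -> 0 <= f x) -> (forall x, D2 x -> 0 <= g x) ->
  (forall x, D1 x -> f x <= g x) ->
  \int[mu]_(x in D1) f x <= \int[mu]_(x in D2) g x.
Proof.
move=> D12 f0 g0 fg; rewrite !ge0_integralE//.
apply: ge_ereal_sup => _ [h /= hf <-]; apply: ereal_sup_ubound; exists h => //= x.
apply: le_trans (hf x) _; rewrite /patch.
case: ifPn => [/set_mem xD1|_]; first by rewrite ifT ?fg//; exact/mem_set/D12.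
by case: ifPn => // /set_mem; exact: g0.
Qed.

(** If a simple [h] lies below f + g, then h <= max(h - g, 0) + g. The first summand is measurable
    and at most f, so additivity for measurable functions applies. *)
Lemma ge0_le_integralD D f g : measurable D ->
  (forall x, D x -> 0 <= f x) -> (forall x, D x -> 0 <= g x) ->
  measurable_fun D g ->
  \int[mu]_(x in D) (f x + g x) <=
  \int[mu]_(x in D) f x + \int[mu]_(x in D) g x.
Proof.
move=> mD f0 g0 mg.
rewrite [leLHS]ge0_integralE//; last by move=> x Dx; rewrite adde_ge0 ?f0 ?g0.
apply: ge_ereal_sup => _ [h /= hfg <-].
have h0 x : 0 <= (h x)%:E by rewrite lee_fin; exact: fun_ge0.
(* Off [D] the truncated f + g is 0, so [h] vanishes there. *)
have -> : sintegral mu h = \int[mu]_(x in D) (h x)%:E.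
  rewrite integral_nnsfun//; congr sintegral; apply/funext => x; rewrite /patch.
  case: ifPn => // xD; apply/eqP; rewrite eq_le fun_ge0 andbT.
  by have := hfg x; rewrite /patch (negbTE xD) lee_fin.
have mh : measurable_fun D (EFin \o h).
  by apply/measurable_EFinP; exact: measurable_funTS.
have mhg : measurable_fun D (fun x => maxe ((h x)%:E - g x) 0).
  by apply: measurable_maxe => //; exact: emeasurable_funB.
apply: (@le_trans _ _ (\int[mu]_(x in D) (maxe ((h x)%:E - g x) 0 + g x))).
  apply: ge0_le_integral_subset => // x Dx.
    by rewrite adde_ge0 ?g0// le_max lexx orbT.
  move: (g0 _ Dx); case: (g x) => [r| |]// r0.
    by rewrite -leeBlDr// le_max lexx.
  by rewrite addey ?leey// gt_eqF// lt_max ltNy0 orbT.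
rewrite ge0_integralD//; last by move=> x _; rewrite le_max lexx orbT.
rewrite leeD2r//; apply: ge0_le_integral_subset => // x Dx.
  by rewrite le_max lexx orbT.
have := hfg x; rewrite /patch mem_set// ge_max (f0 _ Dx) andbT => hx.
move: (g0 _ Dx) (f0 _ Dx) hx; case: (g x) => [r _ _ hx| |]//.
  by rewrite leeBlDr.
by move=> _ ? _; rewrite addeNy// leNye.
Qed.

(** On all of [D], f is at most g plus the function equal to +oo on the exceptional null set and 0
    elsewhere. That function is measurable with integral 0. *)
Lemma ge0_ae_le_integral D f g : measurable D ->
  (forall x, D x -> 0 <= f x) -> (forall x, D x -> 0 <= g x) ->
  {ae mu, forall x, D x -> f x <= g x} ->
  \int[mu]_(x in D) f x <= \int[mu]_(x in D) g x.
Proof.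
move=> mD f0 g0 [N [mN N0 fgN]].
pose h x : \bar R := +oo * (\1_N x)%:E.
have h0 x : 0 <= h x by rewrite mule_ge0.
have mh : measurable_fun D h.
  by apply: emeasurable_funM => //; apply/measurable_EFinP; exact: measurable_indic.
apply: (@le_trans _ _ (\int[mu]_(x in D) (g x + h x))).
  apply: ge0_le_integral_subset => // x Dx; first by rewrite adde_ge0 ?g0.
  rewrite /h indicE; case: (boolP (x \in N)) => xN.
    by rewrite mule1 addey ?leey// gt_eqF// (lt_le_trans _ (g0 _ Dx)).
  rewrite mule0 adde0; apply: contrapT => fg; move: xN; rewrite notin_setE; apply.
  by apply: fgN => /= /(_ Dx).
rewrite (le_trans (ge0_le_integralD _ _ _ _))// -[leRHS]adde0 leeD2l//.
rewrite (_ : integral mu D h = 0)//.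
rewrite -[RHS](integral0 mu D); apply: ae_eq_integral => //.
exists N; split => // x /= hx; apply: contrapT => xN; apply: hx => _.
by rewrite /h indicE memNset// mule0.
Qed.

(** Dividing by [k] turns a simple function below k f into one below f. *)
Lemma ge0_le_integralZl D f (k : R) : (0 < k)%R -> (forall x, D x -> 0 <= f x) ->
  \int[mu]_(x in D) (k%:E * f x) <= k%:E * \int[mu]_(x in D) f x.
Proof.
move=> k0 f0; rewrite !ge0_integralE//; last first.
  by move=> x Dx; rewrite mule_ge0 ?f0// lee_fin ltW.
apply: ge_ereal_sup => _ [h /= hf <-]; rewrite muleC -lee_pdivrMr// muleC.
have k10 : (0 <= k^-1)%R by rewrite invr_ge0 ltW.
rewrite -sintegralrM; apply: ereal_sup_ubound; exists (scale_nnsfun h k10) => //= x.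
rewrite EFinM muleC lee_pdivrMr// muleC.
by have := hf x; rewrite /patch; case: ifPn => // _; rewrite mule0.
Qed.

(** From (u + v)^p <= (2 max(u, v))^p <= (2u)^p + (2v)^p. Only [c] is asked to be measurable, so [b]
    may be [Qgrad Q f]. *)
Lemma integral_powR_le D (a b c : T -> R) (p k l : R) : measurable D ->
  (0 <= p)%R -> (0 < k)%R -> (0 < l)%R -> measurable_fun D c ->
  {ae mu, forall x, D x -> (`|a x| <= k * `|b x| + l * `|c x|)%R} ->
  \int[mu]_(x in D) (`|a x| `^ p)%:E <=
  ((2 * k) `^ p)%:E * \int[mu]_(x in D) (`|b x| `^ p)%:E +
  ((2 * l) `^ p)%:E * \int[mu]_(x in D) (`|c x| `^ p)%:E.
Proof.
move=> mD p0 k0 l0 mc abc.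
have pw0 (u : R) : 0 <= (u `^ p)%:E by rewrite lee_fin powR_ge0.
have mcp : measurable_fun D (fun x => (`|c x| `^ p)%:E).
  apply/measurable_EFinP; apply: (measurableT_comp (measurable_powR p)).
  exact: measurableT_comp.
apply: (@le_trans _ _ (\int[mu]_(x in D)
    (((2 * k) `^ p)%:E * (`|b x| `^ p)%:E + ((2 * l) `^ p)%:E * (`|c x| `^ p)%:E))).
  apply: ge0_ae_le_integral => // [x _|]; first by rewrite adde_ge0 ?mule_ge0.
  apply: filterS abc => x abcx Dx; rewrite -!EFinM -EFinD lee_fin.
  have [u0 v0] : (0 <= k * `|b x| /\ 0 <= l * `|c x|)%R.
    by split; apply: mulr_ge0 => //; exact: ltW.
  rewrite -!powRM ?normr_ge0 ?(mulr_ge0 _ (ltW k0)) ?(mulr_ge0 _ (ltW l0))// -!mulrA.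
  apply: (@le_trans _ _ ((2 * Num.max (k * `|b x|) (l * `|c x|)) `^ p)%R).
    apply: ge0_ler_powR => //; rewrite ?nnegrE ?mulr_ge0// ?le_max ?u0//.
    by apply: le_trans (abcx Dx) _; case: (leP (k * _)%R) => ?; lra.
  by case: (leP (k * _)%R) => _; rewrite ?lerDl ?lerDr powR_ge0.
apply: le_trans (ge0_le_integralD _ _ _ _) _ => //.
- by move=> x _; rewrite mule_ge0.
- by move=> x _; rewrite mule_ge0.
- by apply: emeasurable_funM.
by apply: leeD; apply: ge0_le_integralZl => //; rewrite powR_gt0// mulr_gt0.
Qed.

End nonmeasurable_integrands.

(** * Lebesgue measure on R^n *)

Section row_vectors.
Context (R : realType) (n : nat).
Local Notation V := 'rV[R]_n.+1.
Implicit Types (v x : V) (U : set V).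

Lemma ler_coord_norm v i : `|v 0 i| <= `|v|.
Proof.
by rewrite [leRHS]mx_normrE; apply: (le_bigmax _ (fun ij => `|v ij.1 ij.2|) (0, i)).
Qed.

Lemma rV_norm_lt v e : 0 < e -> (forall i, `|v 0 i| < e) -> `|v| < e.
Proof.
move=> e0 ve; rewrite [ltLHS]mx_normrE; apply/bigmax_ltP; split => // -[i j] _ /=.
by rewrite ord1.
Qed.

Lemma rV_norm_le v e : 0 <= e -> (forall i, `|v 0 i| <= e) -> `|v| <= e.
Proof.
move=> e0 ve; rewrite [leLHS]mx_normrE; apply/bigmax_leP; split => // -[i j] _ /=.
by rewrite ord1.
Qed.

Lemma nbhs_rVP x U : nbhs x U <->
  exists2 e : R, 0 < e & forall y : V, (forall i, `|x 0 i - y 0 i| < e) -> U y.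
Proof.
rewrite -nbhs_nbhs_norm; split=> -[e e0 eU]; exists e => //.
  move=> y xy; apply: eU => /=; apply: rV_norm_lt => // i.
  by rewrite !mxE; exact: xy.
move=> y /= xy; apply: eU => i; apply: le_lt_trans xy.
by have := ler_coord_norm (x - y) i; rewrite !mxE.
Qed.

Lemma rat_rV_dense U : open U -> U !=set0 ->
  exists q : 'rV[rat]_n.+1, U (map_mx ratr q).
Proof.
move=> oU [x Ux]; have /nbhs_rVP[e e0 eU] : nbhs x U by exact: open_nbhs_nbhs.
have /choice[q xq] : forall i, exists q : rat, ratr q \in `](x 0 i - e), (x 0 i + e)[.
  by move=> i; apply: rat_in_itvoo; rewrite ltrD2l gtrN.
exists (\row_i q i); apply: eU => i; rewrite !mxE ltr_norml.
by have := xq i; rewrite in_itv/= => /andP[? ?]; lra.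
Qed.

Lemma rat_box_in_nbhs x U : nbhs x U ->
  exists a b : 'rV[rat]_n.+1, let c := (map_mx ratr a, map_mx ratr b) in
    @open_box R n c x /\ @open_box R n c `<=` U.
Proof.
move=> /nbhs_rVP[e e0 eU].
have /choice[a ax] : forall i, exists q : rat, ratr q \in `](x 0 i - e), (x 0 i)[.
  by move=> i; apply: rat_in_itvoo; rewrite gtrBl.
have /choice[b xb] : forall i, exists q : rat, ratr q \in `](x 0 i), (x 0 i + e)[.
  by move=> i; apply: rat_in_itvoo; rewrite ltrDl.
exists (\row_i a i), (\row_i b i); split => [i|y aby] /=.
  by have := ax i; have := xb i; rewrite !mxE !in_itv/= => /andP[-> _] /andP[_ ->].
apply: eU => i; have := aby i; rewrite /= !mxE ltr_norml.
have := ax i; have := xb i; rewrite !in_itv/=.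
by move=> /andP[? ?] /andP[? ?] /andP[? ?]; lra.
Qed.

End row_vectors.

Section lebesgue_measure_Rn.
Context (R : realType) (n : nat).
Local Notation V := 'rV[R]_n.+1.
Local Notation mu := (lebesgueRn R n).
Implicit Types (A U : set V) (c : V * V).

Definition set_coord (v : V) (i : 'I_n.+1) (z : R) : V :=
  \row_j if j == i then z else v 0 j.

Lemma box_volume_set_coord c i (z w : R) :
  box_volume (set_coord c.1 i z, set_coord c.2 i w) =
  (w - z) * \prod_(j < n.+1 | j != i) (c.2 0 j - c.1 0 j).
Proof.
rewrite /box_volume (bigD1 i)//= !mxE eqxx; congr *%R.
by apply: eq_bigr => j /negbTE ji; rewrite !mxE ji.
Qed.

Lemma set_coord_id (v : V) i : set_coord v i (v 0 i) = v.
Proof. by apply/rowP => j; rewrite mxE; case: eqP => [->|]. Qed.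

Lemma lebesgueRn_le_cover A (s : nat -> V * V) : box_cover A s ->
  (mu A <= \sum_(k <oo) (box_volume (s k))%:E)%E.
Proof. by move=> sA; apply: ereal_inf_lbound; exists s. Qed.

(** Caratheodory's criterion: each box of a cover is cut along the hyperplane into two boxes, whose
    total volume exceeds that of the original by at most e / 2^(k+1). *)
Lemma measurable_halfspace (i : 'I_n.+1) (a : R) :
  measurable [set x : V | x 0 i < a].
Proof.
set H := [set x : V | _]; apply: le_caratheodory_measurable => X.
apply: le_ereal_inf_tmp => _ [c cX <-]; have [c0 Xc] := cX.
apply/lee_addgt0Pr => e e0.
pose P k := \prod_(j < n.+1 | j != i) ((c k).2 0 j - (c k).1 0 j).
have P0 k : 0 <= P k by apply: prodr_ge0 => j _; rewrite subr_ge0.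
(* The denominator [1 + P k] gives d k * P k <= e / 2^(k+1) even when the cross-section [P k] is
   0. *)
pose d k := e / (2 ^ k.+1)%:R / (1 + P k).
have d0 k : 0 < d k.
  by rewrite divr_gt0// ?ltr_pwDl// divr_gt0// ltr0n expn_gt0.
(* [a] is clamped to the side of the box, so that a box lying entirely on one side of the hyperplane
   leaves a degenerate piece instead of one of negative width. *)
pose m k := Num.max ((c k).1 0 i) (Num.min ((c k).2 0 i) a).
(* The box covering the part outside the half-space is enlarged by [d k] to
   contain the hyperplane while staying open. *)
pose l k := Num.min ((c k).2 0 i) (Num.max ((c k).1 0 i) (a - d k)).
have m1 k : (c k).1 0 i <= m k by rewrite le_max lexx.
have l2 k : l k <= (c k).2 0 i by rewrite ge_min lexx.
pose sA k := (set_coord (c k).1 i ((c k).1 0 i), set_coord (c k).2 i (m k)).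
pose sB k := (set_coord (c k).1 i (l k), set_coord (c k).2 i ((c k).2 0 i)).
have cA : box_cover (X `&` H) sA.
  split=> [k j|x [Xx Hx]]; first by rewrite !mxE; case: eqP.
  have [k _ xk] := Xc _ Xx; exists k => // j; rewrite !mxE.
  have := xk j; have := xk i; case: eqP => [->|_ _ ]//.
  move=> /andP[? ?] _; apply/andP; split => //.
  by rewrite lt_max lt_min; apply/orP; right; apply/andP.
have cB : box_cover (X `&` ~` H) sB.
  split=> [k j|x [Xx /negP Hx]]; first by rewrite !mxE; case: eqP.
  have [k _ xk] := Xc _ Xx; exists k => // j; rewrite !mxE.
  have := xk j; have := xk i; case: eqP => [->|_ _ ]//.
  move=> /andP[? ?] _; apply/andP; split => //; rewrite gt_min gt_max.
  apply/orP; right; apply/andP; split=> //.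
  by rewrite (lt_le_trans _ (_ : a <= _)) ?gtrBl// leNgt.
apply: (le_trans (leeD (lebesgueRn_le_cover cA) (lebesgueRn_le_cover cB))).
rewrite -nneseriesD; last 2 first.
- by move=> k _ _; exact: box_volume_ge0 cA.
- by move=> k _ _; exact: box_volume_ge0 cB.
apply: le_trans (epsilon_trick xpredT _ (ltW e0)); last first.
  by move=> k; exact: box_volume_ge0 cX.
apply: lee_nneseries => [k _ _|k _].
  by apply: adde_ge0; [exact: box_volume_ge0 cA|exact: box_volume_ge0 cB].
rewrite -!EFinD lee_fin !box_volume_set_coord -/(P k).
rewrite -[X in _ <= X + _](_ : ((c k).2 0 i - (c k).1 0 i) * P k = _); last first.
  by rewrite -box_volume_set_coord !set_coord_id; case: (c k).
apply: (@le_trans _ _ (((c k).2 0 i - (c k).1 0 i + d k) * P k)).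
  rewrite -mulrDl ler_wpM2r// /m /l; have := c0 k i; have := d0 k.
  by move: (d k) ((c k).1 0 i) ((c k).2 0 i) => t u w ? ?;
    rewrite /Order.min /Order.max; do ![case: ltP => ?]; lra.
rewrite mulrDl lerD2l /d -[leRHS]mulr1 -[leLHS]mulrA ler_wpM2l//.
  by rewrite divr_ge0 ?ltW.
by rewrite mulrC ler_pdivrMr ?ltr_pwDl// mul1r lerDr.
Qed.

Lemma measurable_open_box c : measurable (@open_box R n c).
Proof.
have mlt i (a : R) : measurable [set x : V | a < x 0 i].
  have -> : [set x : V | a < x 0 i] =
      \bigcup_k ~` [set x : V | x 0 i < a + k.+1%:R^-1].
    apply/seteqP; split => [x /= ax|x [k _ /negP]]; last first.
      by rewrite -leNgt; apply: lt_le_trans; rewrite ltrDl.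
    have : 0 < x 0 i - a by rewrite subr_gt0.
    move=> /ltr_add_invr[k]; rewrite add0r => kx; exists k => //=.
    by apply/negP; rewrite -leNgt; rewrite -lerBrDl ltW.
  by apply: bigcupT_measurable => k; apply: measurableC; exact: measurable_halfspace.
have -> : open_box c = ~` \bigcup_i ~` [set x : V | c.1 0 i < x 0 i < c.2 0 i].
  rewrite setC_bigcup; apply/seteqP; split => x xc i => [_|].
    by rewrite setCK; exact: xc.
  by have := xc i I; rewrite setCK.
apply: measurableC; apply: countable_bigcupT_measurable => // i.
apply: measurableC.
have -> : [set x : V | c.1 0 i < x 0 i < c.2 0 i] =
    [set x : V | c.1 0 i < x 0 i] `&` [set x : V | x 0 i < c.2 0 i].
  by apply/seteqP; split => x /= => [/andP[]|[-> ->]].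
by apply: measurableI => //; exact: measurable_halfspace.
Qed.

(** An open set is the union of the boxes with rational corners that it contains, and these are
    countably many. *)
Lemma open_measurable_Rn U : open U -> measurable U.
Proof.
move=> oU; pose W := [set: 'rV[rat]_n.+1 * 'rV[rat]_n.+1].
pose box (ab : 'rV[rat]_n.+1 * 'rV[rat]_n.+1) :=
  @open_box R n (map_mx ratr ab.1, map_mx ratr ab.2).
have -> : U = \bigcup_(ab in [set ab | box ab `<=` U]) box ab.
  apply/seteqP; split => [x Ux|x [ab abU]]; last exact: abU.
  have [a [b [abx abU]]] := rat_box_in_nbhs (open_nbhs_nbhs (conj oU Ux)).
  by exists (a, b).
rewrite bigcup_mkcond; apply: countable_bigcupT_measurable => // ab.
by case: ifP => // _; exact: measurable_open_box.
Qed.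

Lemma continuous_measurable_Rn (D : set V) (f : V -> R) :
  continuous f -> measurable_fun D f.
Proof.
move=> cf; apply: measurable_funTS.
apply: (measurability _ (RGenOpens.measurableE R)) => _ [_ [x [y ->]] <-].
rewrite setTI; apply: open_measurable_Rn.
by apply: open_comp => // x _; exact: cf.
Qed.

Lemma bounded_lebesgueRn_lty A : bounded_set A -> (mu A < +oo)%E.
Proof.
move=> [M [_ MA]]; pose b : V := const_mx (`|M| + 2).
(* One large box, followed by empty boxes of volume 0. *)
pose s k : V * V := if k is 0%N then (- b, b) else (0, 0).
have b0 i : 0 < b 0 i by rewrite mxE ltr_wpDl.
have sA : box_cover A s.
  split=> [[|k] i /=|x Ax]; [|by []|].
    by rewrite !mxE; have := b0 i; rewrite mxE => ?; lra.
  exists 0%N => // i /=; rewrite !mxE -ltr_norml.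
  apply: le_lt_trans (ler_coord_norm _ _) _.
  apply: le_lt_trans (MA (`|M| + 1) _ x Ax) _; last by rewrite ltrD2l ltr1n.
  by rewrite ltr_pwDr// ler_norm.
apply: le_lt_trans (lebesgueRn_le_cover sA) _.
rewrite nneseries_recl//; last by move=> k _; exact: box_volume_ge0 sA.
rewrite eseries0 ?adde0 ?ltry// => -[|k]// _ _.
by rewrite /box_volume big_ord_recl/= subrr mul0r.
Qed.

Lemma lebesgueRn_shift_le A (z : V) :
  (mu [set x | A (x - z)%R] <= mu A)%E.
Proof.
apply: le_ereal_inf_tmp => _ [c [c0 cA] <-].
pose s k := ((c k).1 + z, (c k).2 + z).
have sA : box_cover [set x | A (x - z)] s.
  split=> [k i|x /cA[k _ xk]]; first by rewrite !mxE lerD2r.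
  by exists k => // i; have := xk i; rewrite !mxE ltrBrDr ltrBlDr.
apply: le_trans (lebesgueRn_le_cover sA) _.
apply: lee_nneseries => k _; first by move=> _; exact: box_volume_ge0 sA.
rewrite lee_fin le_eqVlt; apply/orP; left; apply/eqP.
by apply: eq_bigr => i _; rewrite !mxE; ring.
Qed.

(* Countably many translates of a nonempty open set cover the space. *)
Lemma null_open_lebesgueRnT U : open U -> U !=set0 -> mu U = 0%E ->
  mu setT = 0%E.
Proof.
move=> oU U0 muU0.
pose F k := if unpickle k is Some q then
  [set x : V | U (x - map_mx ratr (q : 'rV[rat]_n.+1))] else set0.
have F0 k : mu (F k) = 0%E.
  rewrite /F; case: unpickle => [q|]; last exact: measure0.
  by apply/eqP; rewrite eq_le measure_ge0 andbT -muU0 lebesgueRn_shift_le.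
have TF : [set: V] `<=` \bigcup_k F k.
  move=> x _.
  have [q Uq] : exists q : 'rV[rat]_n.+1, U (x - map_mx ratr q).
    apply: (@rat_rV_dense R n [set y | U (x - y)]).
      by apply: (open_comp _ oU) => y _; apply: continuousB; [exact: cst_continuous|].
    by have [u Uu] := U0; exists (x - u) => /=; rewrite subKr.
  by exists (pickle q) => //; rewrite /F pickleK.
apply/eqP; rewrite eq_le measure_ge0 andbT.
apply: (@le_trans _ _ (\sum_(k <oo) mu (F k))%E).
  apply: le_trans (le_lebesgue_outer TF) _.
  exact: lebesgue_outer_sigma_subadditive.
by rewrite eseries0.
Qed.

End lebesgue_measure_Rn.

(** * Euclidean norm, square roots of matrices, derivatives *)

Section euclidean_norm.
Context (R : realType).

Lemma enorm_ge0 k l (v : 'M[R]_(k, l)) : 0 <= enorm v.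
Proof. exact: sqrtr_ge0. Qed.

Lemma enorm_sqr k l (v : 'M[R]_(k, l)) : enorm v ^+ 2 = \sum_i \sum_j v i j ^+ 2.
Proof.
rewrite sqr_sqrtr// !sumr_ge0// => i _; rewrite sumr_ge0// => j _.
exact: sqr_ge0.
Qed.

Lemma ler_coord_enorm k l (v : 'M[R]_(k, l)) i j : `|v i j| <= enorm v.
Proof.
rewrite -ler_sqr ?nnegrE ?enorm_ge0// enorm_sqr real_normK ?num_real//.
rewrite (bigD1 i)//= (bigD1 j)//= -addrA lerDl addr_ge0//.
  by rewrite sumr_ge0// => ? _; exact: sqr_ge0.
by rewrite sumr_ge0// => ? _; rewrite sumr_ge0// => ? _; exact: sqr_ge0.
Qed.

Lemma enorm_le k (v : 'cV[R]_k) M : 0 <= M -> (forall i, `|v i 0| <= M) ->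
  enorm v <= k%:R * M.
Proof.
move=> M0 vM; rewrite -ler_sqr ?nnegrE ?enorm_ge0 ?mulr_ge0// enorm_sqr.
apply: (@le_trans _ _ (\sum_(i < k) M ^+ 2)).
  apply: ler_sum => i _; rewrite big_ord1 -(real_normK (num_real (v i 0))).
  by rewrite ler_sqr ?nnegrE.
rewrite sumr_const card_ord -[leLHS]mulr_natl exprMn ler_wpM2r ?sqr_ge0//.
by case: k {v vM} => [|k]; rewrite ?expr0n// -natrX ler_nat leq_pmulr.
Qed.

Lemma enormZ k l (a : R) (v : 'M[R]_(k, l)) : enorm (a *: v) = `|a| * enorm v.
Proof.
apply/eqP; rewrite -(@eqrXn2 _ 2)// ?enorm_ge0 ?mulr_ge0 ?enorm_ge0//.
rewrite exprMn !enorm_sqr real_normK ?num_real// mulr_sumr; apply/eqP.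
apply: eq_bigr => i _; rewrite mulr_sumr; apply: eq_bigr => j _.
by rewrite mxE exprMn.
Qed.

(* The factor 2 dispenses with the Cauchy-Schwarz inequality. *)
Lemma enormD_le k l (u v : 'M[R]_(k, l)) :
  enorm (u + v) <= 2 * (enorm u + enorm v).
Proof.
have [u0 v0] := (enorm_ge0 u, enorm_ge0 v).
rewrite -ler_sqr ?nnegrE ?enorm_ge0 ?mulr_ge0 ?addr_ge0//.
apply: (@le_trans _ _ (2 * (enorm u ^+ 2 + enorm v ^+ 2))); last by nra.
rewrite !enorm_sqr -big_split mulr_sumr; apply: ler_sum => i _ /=.
rewrite -big_split mulr_sumr; apply: ler_sum => j _ /=; rewrite mxE.
have := sqr_ge0 (u i j - v i j); nra.
Qed.

Lemma enorm0 k l : enorm (0 : 'M[R]_(k, l)) = 0.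
Proof. by rewrite -(scale0r 0) enormZ normr0 mul0r. Qed.

Lemma enorm_eq0 k l (v : 'M[R]_(k, l)) : enorm v = 0 -> v = 0.
Proof.
move=> v0; apply/matrixP => i j; rewrite mxE; apply/eqP.
by rewrite -normr_le0 -v0 ler_coord_enorm.
Qed.

Lemma enorm_rowB_sqr k (x y : 'rV[R]_k) :
  enorm (x - y) ^+ 2 = \sum_i (x 0 i - y 0 i) ^+ 2.
Proof. by rewrite enorm_sqr big_ord1; apply: eq_bigr => i _; rewrite !mxE. Qed.

End euclidean_norm.

Section sqrtmx_bound.
Context (R : realType) (n : nat).
Implicit Types (A : 'M[R]_n) (v : 'cV[R]_n).

Lemma enorm_mulmx_opnorm A v : enorm (A *m v) <= opnorm A * enorm v.
Proof.
have [v0|vN0] := eqVneq (enorm v) 0.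
  by rewrite v0 (enorm_eq0 v0) mulmx0 enorm0 mulr0.
have vgt0 : 0 < enorm v by rewrite lt_neqAle eq_sym vN0 enorm_ge0.
rewrite -ler_pdivrMr// mulrC -[X in X * _]gtr0_norm ?invr_gt0// -enormZ scalemxAr.
pose w := (enorm v)^-1 *: v; rewrite -/w.
have w1 : enorm w = 1 by rewrite enormZ gtr0_norm ?invr_gt0// mulVf.
apply: ub_le_sup; last by exists w.
(* [sup] dominates the elements of a set only if the set is bounded; this is a crude bound on |A xi|
   over unit vectors. *)
exists (n%:R * \sum_i \sum_j `|A i j|) => _ [xi /= xi1 <-].
apply: enorm_le => [|i]; first by rewrite !sumr_ge0// => i _; rewrite sumr_ge0.
rewrite mxE (le_trans (ler_norm_sum _ _ _))//.
rewrite [leRHS](bigD1 i)//= (le_trans (_ : _ <= \sum_j `|A i j|))//.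
  by apply: ler_sum => j _; rewrite normrM ler_piMr// -xi1 ler_coord_enorm.
by rewrite lerDl sumr_ge0// => ? _; rewrite sumr_ge0.
Qed.

(* [sqrtmx A] is 0 when [A] has no positive semi-definite square root. *)
Lemma enorm_sqrtmx_sqr_le A v :
  enorm (sqrtmx A *m v) ^+ 2 <= n%:R * opnorm A * enorm v ^+ 2.
Proof.
have Av0 : 0 <= n%:R * opnorm A * enorm v ^+ 2.
  rewrite expr2 mulrA -[X in X * enorm v]mulrA mulr_ge0 ?enorm_ge0// mulr_ge0//.
  exact: le_trans (enorm_ge0 _) (enorm_mulmx_opnorm _ _).
rewrite /sqrtmx; case: xgetP => [S _ [[ST _] SA]|_]; last first.
  by rewrite mul0mx enorm0 expr0n.
(* As S is symmetric, |S v|^2 = v^T A v. This is a sum of [n] products, each at most |v| |A v|,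
   whence the factor [n]. *)
have dotE (w : 'cV[R]_n) : enorm w ^+ 2 = (w^T *m w) 0 0.
  rewrite enorm_sqr mxE; apply: eq_bigr => i _.
  by rewrite big_ord1 mxE expr2.
rewrite dotE trmx_mul ST -mulmxA (mulmxA S) SA mxE.
rewrite -mulrA mulr_natl -[X in _ *+ X]card_ord -sumr_const.
apply: ler_sum => i _; rewrite mxE; apply: (le_trans (ler_norm _)).
rewrite normrM expr2 mulrA mulrC ler_pM// ?ler_coord_enorm//.
exact: le_trans (ler_coord_enorm _ _ _) (enorm_mulmx_opnorm _ _).
Qed.

End sqrtmx_bound.

Section derivatives.
Context (R : realType).

Lemma near_eq_differentiable (V W : normedModType R) (f g : V -> W) x :
  (\near x, f x = g x) -> differentiable f x -> differentiable g x.
Proof.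
move=> fg df; have fgx := nbhs_singleton fg.
have dg : g \o shift x = cst (g x) + 'd f x +o_ 0 id.
  apply/eqaddoP => e e0; have /eqaddoP/(_ e e0) := diff_locally df.
  move: fg; rewrite (near_shift 0) => fg; apply: filterS2 fg => h /=.
  by rewrite subr0 !fctE/= => -> ; rewrite fgx.
apply/diff_locallyP; rewrite (diff_unique _ dg)//; last exact: diff_continuous.
by split => //; exact: diff_continuous.
Qed.

(** The difference quotient is within M |h| of [d]. This serves both for the square of the positive
    part and for a product whose second factor vanishes to second order. *)
Lemma quadratic_is_derive (V : normedModType R) (f : V -> R) x v d M :
  (forall h, `|f (h *: v + x) - f x - h * d| <= M * h ^+ 2) -> is_derive x v f d.
Proof.
move=> fM.
suff fd : h^-1 *: ((f \o shift x) (h *: v) - f x) @[h --> 0^'] --> d.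
  by apply: DeriveDef; [apply/cvg_ex; exists d|exact: cvg_lim fd].
(* The hypothesis at h = 1 bounds an absolute value by [M]. *)
have M0 : 0 <= M by have := fM 1; rewrite expr1n mulr1; exact: le_trans.
apply/cvgrPdist_le => e e0; near=> h.
have h0 : h != 0 by near: h; exact: nbhs_dnbhs_neq.
rewrite -[_ *: _]/(_ * _) distrC -[X in _ - X](mulKf h0) -mulrBr normrM normfV.
rewrite ler_pdivrMl ?normr_gt0//; apply: le_trans (fM h) _.
rewrite -[h ^+ 2]real_normK ?num_real// expr2 mulrCA ler_wpM2l//.
have hM : `|h| <= e / (1 + M).
  near: h; apply: dnbhs0_le; by rewrite divr_gt0// ltr_pwDl.
apply: le_trans (_ : (1 + M) * `|h| <= _); first by rewrite ler_wpM2r// lerDr.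
by rewrite mulrC -ler_pdivlMr// ltr_pwDl.
Unshelve. all: by end_near. Qed.

Lemma derive_lipschitz_le (V : normedModType R) (f : V -> R) x v L :
  derivable f x v -> (forall y z, `|f y - f z| <= L * `|y - z|) ->
  `|'D_v f x| <= L * `|v|.
Proof.
move=> df fL.
have bound : \forall h \near 0^',
    `|h^-1 *: ((f \o shift x) (h *: v) - f x)| <= L * `|v|.
  near=> h; have h0 : h != 0 by near: h; exact: nbhs_dnbhs_neq.
  rewrite -[_ *: _]/(_ * _) normrM normfV ler_pdivrMl ?normr_gt0//.
  by rewrite (le_trans (fL _ _))//= addrK normrZ mulrCA.
rewrite ler_norml; apply/andP; split.
  by apply: limr_ge => //; apply: filterS bound => h; rewrite ler_norml => /andP[].
by apply: limr_le => //; apply: filterS bound => h; rewrite ler_norml => /andP[].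
Unshelve. all: by end_near. Qed.

End derivatives.

(** * Cutoff functions *)

Lemma differentiable_enorm_rowB_sqr (R : realType) n (y x : 'rV[R]_n.+1) :
  differentiable (fun x : 'rV[R]_n.+1 => enorm (x - y) ^+ 2) x.
Proof.
rewrite (_ : (fun x => _) =
    \sum_(i < n.+1) ((fun x : 'rV[R]_n.+1 => x 0 i : R) - cst (y 0 i)) ^+ 2).
  apply: differentiable_sum => i; apply: differentiableX.
  by apply: differentiableB; [exact: differentiable_coord|exact: differentiable_cst].
by apply/funext => z; rewrite enorm_rowB_sqr fct_sumE; apply: eq_bigr.
Qed.

Section cutoff.
Context (R : realType) (n : nat).
Local Notation V := 'rV[R]_n.+1.
Variables (y : V) (t : R).
Hypothesis t0 : 0 < t.

Definition cutoff_root (x : V) : R :=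
  Num.max 0 (2 - enorm (x - y) ^+ 2 / t ^+ 2).

(** At least 1 for |x - y| <= t, and 0 once |x - y|^2 >= 2 t^2. The outer square makes the function
    differentiable everywhere and makes it vanish to second order at each of its zeros. *)
Definition cutoff (x : V) : R := cutoff_root x ^+ 2.

Lemma cutoff_root_ge0 x : 0 <= cutoff_root x.
Proof. by rewrite le_max lexx. Qed.

Lemma cutoff_root_le2 x : cutoff_root x <= 2.
Proof. by rewrite ge_max ler0n gerBl divr_ge0// sqr_ge0. Qed.

Lemma cutoff_ge0 x : 0 <= cutoff x. Proof. exact: sqr_ge0. Qed.

Lemma cutoff_le4 x : cutoff x <= 4.
Proof.
by have := cutoff_root_ge0 x; have := cutoff_root_le2 x; rewrite /cutoff; nra.
Qed.

Lemma cutoff_ge1 x : enorm (x - y) <= t -> 1 <= cutoff x.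
Proof.
move=> xt; have xt2 : enorm (x - y) ^+ 2 / t ^+ 2 <= 1.
  by rewrite ler_pdivrMr ?exprn_gt0// mul1r ler_sqr ?nnegrE ?enorm_ge0// ltW.
have : 1 <= cutoff_root x by rewrite le_max; apply/orP; right; lra.
by rewrite /cutoff; nra.
Qed.

Lemma cutoff_neq0 x : cutoff x != 0 -> enorm (x - y) ^+ 2 < 2 * t ^+ 2.
Proof.
rewrite /cutoff expf_eq0/= /cutoff_root; case: (ltP 0) => [h _|_]; last by rewrite eqxx.
by rewrite -ltr_pdivrMr ?exprn_gt0//; lra.
Qed.

Definition cutoff_root_lip : R := 4 * n.+1%:R / t.

Lemma cutoff_root_lip_ge0 : 0 <= cutoff_root_lip.
Proof. by rewrite divr_ge0 ?mulr_ge0 ?ltW. Qed.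

(** By symmetry it is enough to bound root(u) - root(v) when root(u) is nonzero, so that u is near
    y. If some coordinate of v is farther than 2t from that of y, then |u - v| >= t/2 and the bound
    root(u) <= 2 suffices. Otherwise each coordinate contributes at most 4t |u - v| to the
    difference of the squared distances. *)
Lemma cutoff_root_lipschitz x z :
  `|cutoff_root x - cutoff_root z| <= cutoff_root_lip * `|x - z|.
Proof.
suff H u v : cutoff_root u - cutoff_root v <= cutoff_root_lip * `|u - v|.
  by rewrite ler_norml lerNl opprB H andbT distrC H.
have LH := cutoff_root_lip_ge0.
have [u0|uN0] := eqVneq (cutoff_root u) 0.
  by rewrite u0 sub0r (@le_trans _ _ 0) ?(mulr_ge0 LH)// oppr_le0 cutoff_root_ge0.
(* 3/2 is larger than the square root of 2. *)
have uy i : `|u 0 i - y 0 i| < 3 / 2 * t.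
  have := ler_coord_enorm (u - y) 0 i; rewrite !mxE => /le_lt_trans; apply.
  rewrite -ltr_sqr ?nnegrE ?enorm_ge0 ?mulr_ge0 ?ltW//.
  apply: lt_le_trans (cutoff_neq0 _) _; first by rewrite /cutoff expf_eq0.
  by nra.
have [/existsP[i vi]|] := boolP [exists i, 2 * t < `|v 0 i - y 0 i|].
  have uv : t / 2 <= `|u - v|.
    apply: le_trans (ler_coord_norm _ i); rewrite !mxE.
    have := uy i; have := ler_distD (u 0 i) (v 0 i) (y 0 i).
    by rewrite (distrC (v 0 i) (u 0 i)); lra.
  rewrite (@le_trans _ _ 2)//.
    by have := cutoff_root_ge0 v; have := cutoff_root_le2 u; lra.
  apply: le_trans (ler_wpM2l LH uv); rewrite /cutoff_root_lip.
  rewrite (_ : _ * (t / 2) = 2 * n.+1%:R); last by field; rewrite gt_eqF.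
  by rewrite ler_peMr// ler1n.
rewrite negb_exists => /forallP vy.
apply: (@le_trans _ _ (`|enorm (v - y) ^+ 2 - enorm (u - y) ^+ 2| / t ^+ 2)).
  rewrite -[X in _ / X]gtr0_norm ?exprn_gt0// -normfV -normrM mulrBl.
  rewrite ler_normr; apply/orP; left; move: uN0; rewrite /cutoff_root.
  move: (enorm (v - y) ^+ 2 / t ^+ 2) (enorm (u - y) ^+ 2 / t ^+ 2) => a b.
  by case: (ltP 0 (2 - b)) => [|_ /eqP//]; case: (ltP 0 (2 - a)) => *; lra.
rewrite ler_pdivrMr ?exprn_gt0// !enorm_rowB_sqr -sumrB.
apply: le_trans (ler_norm_sum _ _ _) _.
apply: (@le_trans _ _ (\sum_(i < n.+1) (4 * t * `|u - v|))); last first.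
  rewrite sumr_const card_ord -[leLHS]mulr_natl /cutoff_root_lip le_eqVlt.
  by apply/orP; left; apply/eqP; field; rewrite gt_eqF.
apply: ler_sum => i _.
have -> : (v 0 i - y 0 i) ^+ 2 - (u 0 i - y 0 i) ^+ 2 =
  ((v 0 i - y 0 i) + (u 0 i - y 0 i)) * (v 0 i - u 0 i) by ring.
rewrite normrM ler_pM//; last first.
  by have := ler_coord_norm (v - u) i; rewrite !mxE [`|v - u|]distrC.
have := ler_normD (v 0 i - y 0 i) (u 0 i - y 0 i).
by have := uy i; have := vy i; have := t0; rewrite -leNgt => *; lra.
Qed.

Definition cutoff_lip : R := 4 * cutoff_root_lip.

Lemma cutoff_lip_ge0 : 0 <= cutoff_lip.
Proof. by rewrite mulr_ge0 ?cutoff_root_lip_ge0. Qed.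

Lemma cutoff_lipschitz x z : `|cutoff x - cutoff z| <= cutoff_lip * `|x - z|.
Proof.
rewrite /cutoff subr_sqr mulrC normrM /cutoff_lip -mulrA ler_pM//.
  have := cutoff_root_ge0 x; have := cutoff_root_ge0 z.
  have := cutoff_root_le2 x; have := cutoff_root_le2 z.
  by move=> *; rewrite ger0_norm; lra.
exact: cutoff_root_lipschitz.
Qed.

Lemma cutoff_le_sqr x z : cutoff x = 0 -> cutoff z <= (cutoff_root_lip * `|z - x|) ^+ 2.
Proof.
move=> /eqP; rewrite /cutoff expf_eq0/= => /eqP x0.
rewrite ler_sqr ?nnegrE ?cutoff_root_ge0 ?(mulr_ge0 cutoff_root_lip_ge0)//.
have := cutoff_root_lipschitz z x; rewrite x0 subr0.
by rewrite ger0_norm ?cutoff_root_ge0.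
Qed.

Lemma is_derive_sqr_max0 (s : R) :
  is_derive s 1 (fun s : R => Num.max 0 s ^+ 2) (2 * Num.max 0 s).
Proof.
apply: (@quadratic_is_derive _ _ _ _ _ _ 1) => h; rewrite mul1r [h *: 1]mulr1.
rewrite ler_norml; case: (ltP 0 (h + s)) => ?; case: (ltP 0 s) => ?;
by apply/andP; split; nra.
Qed.

Lemma cutoff_differentiable x : differentiable cutoff x.
Proof.
pose u (x : V) : R := 2 - enorm (x - y) ^+ 2 / t ^+ 2.
have du : differentiable u x.
  rewrite (_ : u = cst 2 - (fun x : V => enorm (x - y) ^+ 2) * cst (t ^- 2))//.
  apply: differentiableB; first exact: differentiable_cst.
  apply: differentiableM; last exact: differentiable_cst.
  exact: differentiable_enorm_rowB_sqr.
apply: (@differentiable_comp _ _ _ _ u (fun s : R => Num.max 0 s ^+ 2)) => //.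
by apply/derivable1_diffP; apply: ex_derive; exact: is_derive_sqr_max0.
Qed.

(* No Leibniz rule can be expected where [f] is not differentiable.  There,
   either the cutoff is nonzero, [f * cutoff] is not differentiable and its
   gradient is the junk value 0, or the cutoff vanishes to second order and the
   gradient of [f * cutoff] is 0. *)
Lemma gradient_mul_cutoff (f : V -> R) B x : (forall z, `|f z| <= B) ->
  gradient (fun z => f z * cutoff z) x = 0 \/
  gradient (fun z => f z * cutoff z) x =
    cutoff x *: gradient f x + f x *: gradient cutoff x.
Proof.
move=> fB; rewrite {1 2}/gradient; case: asboolP => [dfb|]; last by left.
have [b0|bN0] := eqVneq (cutoff x) 0.
  left; apply/colP => i; rewrite !mxE.
  pose v : V := delta_mx 0 i.
  suff : is_derive x v (fun z => f z * cutoff z) 0 by move=> [].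
  apply: (@quadratic_is_derive _ _ _ _ _ _ (B * (cutoff_root_lip * `|v|) ^+ 2)) => h.
  rewrite b0 !mulr0 !subr0 normrM -mulrA ler_pM//.
  rewrite (ger0_norm (cutoff_ge0 _)) (le_trans (cutoff_le_sqr _ b0))// addrK normrZ.
  by rewrite !exprMn (real_normK (num_real h)) [h ^+ 2 * _]mulrC mulrA.
(* Near x the cutoff is nonzero, and f is the product divided by the cutoff. *)
right; have df : differentiable f x.
  have db := cutoff_differentiable x.
  have := differentiableM dfb (differentiableV db bN0).
  apply: near_eq_differentiable.
  have : {for x, continuous cutoff} by exact: differentiable_continuous.
  move=> /cvgr_neq0/(_ bN0); apply: filterS => z bz.
  by rewrite !fctE/= mulfK.
have db := cutoff_differentiable x.
rewrite /gradient !asboolT//; apply/colP => i; rewrite !mxE.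
rewrite (_ : (fun z => _) = f * cutoff)//.
rewrite (deriveM (diff_derivable df) (diff_derivable db)); exact: addrC.
Qed.

Lemma enorm_gradient_cutoff_le x : enorm (gradient cutoff x) <= n.+1%:R * cutoff_lip.
Proof.
apply: enorm_le => [|i]; first exact: cutoff_lip_ge0.
rewrite /gradient asboolT ?mxE; last exact: cutoff_differentiable.
have := @derive_lipschitz_le _ _ _ x (delta_mx 0 i) _ _ cutoff_lipschitz.
move=> /(_ (diff_derivable (cutoff_differentiable x)))/le_trans; apply.
rewrite ler_piMr ?cutoff_lip_ge0//; apply: rV_norm_le => // j.
by rewrite mxE eqxx/=; case: eqP; rewrite ?normr1 ?normr0.
Qed.

(** When the gradient of the product is 0 the bound is trivial; otherwise it follows from the
    product rule. The factor 2 comes from [enormD_le], and 8 is 2 times the bound 4 on the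
    cutoff. *)
Lemma Qgrad_mul_cutoff_le (Q : V -> 'M[R]_n.+1) (f : V -> R) B L x :
  (forall z, `|f z| <= B) ->
  (forall v : 'cV_n.+1, enorm (sqrtmx (Q x) *m v) <= L * enorm v) ->
  Qgrad Q (fun z => f z * cutoff z) x <=
  8 * Qgrad Q f x + 2 * (L * (n.+1%:R * cutoff_lip)) * `|f x|.
Proof.
move=> fB QL.
(* Applying the hypothesis to a nonzero vector forces [L] to be nonnegative. *)
have L0 : 0 <= L.
  have := QL (const_mx 1); have : 0 < enorm (const_mx 1 : 'cV[R]_n.+1).
    by have := ler_coord_enorm (const_mx 1 : 'cV[R]_n.+1) 0 0; rewrite mxE normr1; lra.
  by move=> p0 /(le_trans (enorm_ge0 _)); rewrite pmulr_lge0.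
have Qf := enorm_ge0 (sqrtmx (Q x) *m gradient f x).
rewrite {1 2}/Qgrad; case: (gradient_mul_cutoff x fB) => ->.
  rewrite mulmx0 enorm0; apply: addr_ge0; first exact: mulr_ge0.
  by rewrite mulr_ge0// mulr_ge0// mulr_ge0// mulr_ge0// cutoff_lip_ge0.
rewrite mulmxDr -!scalemxAr (le_trans (enormD_le _ _))// mulrDr lerD//.
  rewrite enormZ (ger0_norm (cutoff_ge0 _)).
  by have := cutoff_le4 x; have := cutoff_ge0 x; nra.
rewrite enormZ -mulrA ler_wpM2l// mulrC ler_wpM2r// (le_trans (QL _))//.
by rewrite ler_wpM2l// enorm_gradient_cutoff_le.
Qed.

End cutoff.

(** * Lipschitz functions and balls *)

Section Lpmean_bounds.
Context (R : realType) (n : nat).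
Local Notation V := 'rV[R]_n.+1.
Local Notation mu := (lebesgueRn R n).

Lemma powR_invK (a q : R) : 0 <= a -> q != 0 -> (a `^ q^-1) `^ q = a.
Proof. by move=> a0 q0; rewrite -powRrM mulVf// powRr1. Qed.

Lemma integral_powR_ge0 (A : set V) q (g : V -> R) :
  (0 <= \int[mu]_(x in A) (`|g x| `^ q)%:E)%E.
Proof. by apply: integral_ge0 => x _; rewrite lee_fin powR_ge0. Qed.

Lemma fine_lebesgueRn_ge0 (A : set V) : 0 <= fine (mu A).
Proof. exact/fine_ge0/measure_ge0. Qed.

Lemma Lpmean_le (A : set V) q (g : V -> R) b : 0 < q ->
  (\int[mu]_(x in A) (`|g x| `^ q)%:E <= b%:E)%E ->
  (Lpmean A q g <= (((fine (mu A))^-1 * b) `^ q^-1)%:E)%E.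
Proof.
move=> q0 gb; have b0 : 0 <= b.
  by rewrite -lee_fin (le_trans (integral_powR_ge0 A q g)).
have A0 : 0 <= (fine (mu A))^-1 by rewrite invr_ge0 fine_lebesgueRn_ge0.
rewrite /Lpmean -poweR_EFin; apply: gt0_ler_poweR.
- by rewrite invr_ge0 ltW.
- by rewrite in_itv/= leey andbT mule_ge0// integral_powR_ge0.
- by rewrite in_itv/= leey andbT lee_fin mulr_ge0.
by rewrite EFinM lee_wpmul2l.
Qed.

Lemma Lpmean_ge (A : set V) q (g : V -> R) a : 0 < q -> 0 <= a ->
  (0 < mu A < +oo)%E -> (Lpmean A q g <= a%:E)%E ->
  (\int[mu]_(x in A) (`|g x| `^ q)%:E <= (fine (mu A) * a `^ q)%:E)%E.
Proof.
move=> q0 a0 /andP[A0 Aoo] ga.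
have fA0 : 0 < fine (mu A) by rewrite fine_gt0// A0.
have I0 := integral_powR_ge0 A q g; move: ga; rewrite /Lpmean.
move: (integral _ _ _) I0 => [i| |]// i0.
  rewrite -EFinM poweR_EFin !lee_fin => ia.
  rewrite mulrC -ler_pdivrMr// mulrC -[leLHS](@powR_invK _ q) ?gt_eqF//.
    by apply: ge0_ler_powR => //; rewrite ?nnegrE ?powR_ge0// ltW.
  by rewrite mulr_ge0// invr_ge0 ltW.
(* If the integral were infinite, the mean would be too, against its finite bound [a]. *)
by rewrite gt0_muley ?lte_fin ?invr_gt0// poweRyr ?gt_eqF ?invr_gt0.
Qed.

End Lpmean_bounds.

Section Lip0_functions.
Context (R : realType) (n : nat).
Local Notation V := 'rV[R]_n.+1.
Implicit Types (U : set V) (f : V -> R).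

Lemma lipschitzP f : lipschitz f <->
  exists2 k : R, 0 < k & forall x z, `|f x - f z| <= k * `|x - z|.
Proof.
split=> [/pinfty_ex_gt0[k k0 fk]|[k k0 fk]].
  by exists k => // x z; exact: (fk (x, z)).
apply: (@klipschitzW _ _ _ k); first exact: (@globally_properfilter _ _ (0, 0)).
by move=> [x z] _; exact: fk.
Qed.

Lemma Lip0_continuous U f : Lip0 U f -> continuous f.
Proof.
move=> [/lipschitzP[k k0 fk] _] x.
apply/(@cvgrPdist_lt _ _ _ (nbhs x) (nbhs_filter x)) => e e0.
rewrite /prop_near1 -nbhs_nbhs_norm; exists (e / k); first exact: divr_gt0.
by move=> z /= xz; apply: le_lt_trans (fk _ _) _; rewrite mulrC -ltr_pdivlMr.
Qed.

Lemma Lip0_bounded U f : Lip0 U f -> exists2 B, 0 < B & forall x, `|f x| <= B.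
Proof.
move=> [/lipschitzP[k k0 fk] [[M [_ SM]] _]].
have kM : 0 < k * (`|M| + 1) by rewrite mulr_gt0// ltr_wpDl.
exists (`|f 0| + k * (`|M| + 1)) => [|x]; first by rewrite ltr_wpDl.
have [->|fx0] := eqVneq (f x) 0; first by rewrite normr0 addr_ge0// ltW.
have xM : `|x| <= `|M| + 1.
  apply: (SM (`|M| + 1)); first by rewrite ltr_pwDr// ler_norm.
  exact: subset_closure.
have := fk x 0; rewrite subr0 => fx.
rewrite -[f x](subrK (f 0)) (le_trans (ler_normD _ _))// [leLHS]addrC lerD2l.
by rewrite (le_trans fx)// ler_wpM2l// ltW.
Qed.

Lemma Lip0_outside U f x : Lip0 U f -> ~ U x -> \near x, f x = 0.
Proof.
move=> [_ [_ fU]] Ux; have : open (~` closure [set x | f x != 0]).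
  exact/closed_openC/closed_closure.
rewrite openE => /(_ x); case; last first.
  move=> e /= e0 xe; exists e => // z /xe; apply: contra_notP => /eqP fz.
  exact: subset_closure.
by move=> fx; apply: Ux; apply: fU; exact: subset_closure.
Qed.

Lemma Qgrad_outside U (Q : V -> 'M[R]_n.+1) f x : Lip0 U f -> ~ U x -> Qgrad Q f x = 0.
Proof.
move=> fL Ux; rewrite /Qgrad (_ : gradient f x = 0) ?mulmx0 ?enorm0//.
rewrite /gradient; case: asboolP => // _; apply/colP => i; rewrite !mxE.
by rewrite (@near_eq_derive _ _ _ _ (cst 0)) ?derive_cst//; exact: Lip0_outside fL Ux.
Qed.

Lemma Lip0S U W f : U `<=` W -> Lip0 U f -> Lip0 W f.
Proof. by move=> UW [fL [fB fU]]; split=> //; split => // x /fU /UW. Qed.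

End Lip0_functions.

Section balls.
Context (R : realType) (n : nat).
Local Notation V := 'rV[R]_n.+1.
Implicit Types (U Omega : set V) (y : V).

Lemma continuous_enorm_rowB_sqr y : continuous (fun x : V => enorm (x - y) ^+ 2).
Proof.
by move=> x; apply: differentiable_continuous; exact: differentiable_enorm_rowB_sqr.
Qed.

Lemma continuous_enorm_rowB y : continuous (fun x : V => enorm (x - y)).
Proof.
move=> x; rewrite (_ : (fun x => _) = Num.sqrt \o (fun x : V => enorm (x - y) ^+ 2)).
  by apply: continuous_comp; [exact: continuous_enorm_rowB_sqr|exact: sqrt_continuous].
by apply/funext => z /=; rewrite sqrtr_sqr ger0_norm ?enorm_ge0.
Qed.

Lemma open_eball Omega y r : open Omega -> open (eball Omega y r).
Proof.
move=> oO; apply: openI => //.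
apply: (@open_comp _ _ (fun x : V => enorm (x - y)) [set s | s < r]).
  by move=> x _; exact: continuous_enorm_rowB.
exact: open_lt.
Qed.

Lemma eball_center Omega y r : Omega y -> 0 < r -> eball Omega y r y.
Proof. by move=> Oy r0; split=> //=; rewrite subrr enorm0. Qed.

Lemma bounded_set_norm_le U M : (forall x, U x -> `|x| <= M) -> bounded_set U.
Proof.
move=> UM; exists M; split; first exact: num_real.
by move=> M' MM' x /UM /le_trans; apply; exact: ltW.
Qed.

Lemma enorm_rowB_norm_le x y r : enorm (x - y) <= r -> `|x : V| <= `|y| + r.
Proof.
move=> xy; rewrite -[x](subrK y) addrC (le_trans (ler_normD _ _))// lerD2l.
apply: rV_norm_le => [|i]; first exact: le_trans (enorm_ge0 _) xy.
exact: le_trans (ler_coord_enorm _ _ _) xy.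
Qed.

Lemma bounded_eball Omega y r : bounded_set (eball Omega y r).
Proof.
by apply: (@bounded_set_norm_le _ (`|y| + r)) => x [_ /ltW]; exact: enorm_rowB_norm_le.
Qed.

(** The cutoff alone confines the support, to a closed Euclidean ball contained in [W]. The product
    is Lipschitz because both factors are Lipschitz and bounded. *)
Lemma Lip0_mul_cutoff U W f y t : 0 < t -> Lip0 U f ->
  [set x | enorm (x - y) ^+ 2 <= 2 * t ^+ 2] `<=` W ->
  Lip0 W (fun x => f x * cutoff y t x).
Proof.
move=> t0 fL CW; have [B B0 fB] := Lip0_bounded fL.
have [/lipschitzP[k k0 fk] _] := fL.
have SC : closure [set x | f x * cutoff y t x != 0] `<=`
    [set x | enorm (x - y) ^+ 2 <= 2 * t ^+ 2].
  rewrite [X in _ `<=` X](_ : _ = closure [set x | enorm (x - y) ^+ 2 <= 2 * t ^+ 2]).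
    apply: closure_subset => x /=; rewrite mulf_eq0 negb_or => /andP[_ bx].
    by apply/ltW; exact: cutoff_neq0 bx.
  apply/closure_id; apply: (@preimage_closed _ _ (fun x : V => enorm (x - y) ^+ 2)
    [set s | s <= 2 * t ^+ 2]); last exact: closed_le.
  by move=> x _; exact: continuous_enorm_rowB_sqr.
split.
  apply/lipschitzP; exists (B * cutoff_lip n t + 4 * k).
    by rewrite ltr_wpDl ?mulr_gt0// mulr_ge0 ?(cutoff_lip_ge0 n t0)// ltW.
  move=> x z.
  rewrite (_ : _ - _ = f x * (cutoff y t x - cutoff y t z) + cutoff y t z * (f x - f z)).
    rewrite (le_trans (ler_normD _ _))// (normrM (f x)) (normrM (cutoff _ _ _)) mulrDl lerD//.
      by rewrite -[leRHS]mulrA ler_pM// cutoff_lipschitz.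
    rewrite -[leRHS]mulrA ler_pM//.
    by rewrite ger0_norm ?cutoff_ge0// cutoff_le4.
  by ring.
split.
  apply: (@bounded_set_norm_le _ (`|y| + 2 * t)) => x /SC /= xt.
  apply: enorm_rowB_norm_le.
  rewrite -ler_sqr ?nnegrE ?enorm_ge0 ?(mulr_ge0 _ (ltW t0))// (le_trans xt)//.
  by rewrite exprMn ler_wpM2r ?sqr_ge0//; lra.
by rewrite -(closure_id _).1; [move=> x /SC/CW|exact: closed_closure].
Qed.

End balls.

(** * Control by the energy *)

Section sqrtmx_ae_bound.
Context (R : realType) (n : nat) (Omega : set 'rV[R]_n.+1).
Local Notation mu := (lebesgueRn R n).

Lemma Linfty_sqrtmx_bound (Q : 'rV[R]_n.+1 -> 'M[R]_n.+1) :
  (0 < mu setT)%E -> Linfty_mx Omega Q ->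
  exists2 L : R, 0 < L & {ae mu, forall x, Omega x ->
    forall v : 'cV_n.+1, enorm (sqrtmx (Q x) *m v) <= L * enorm v}.
Proof.
(* The L^oo norm unfolds to an essential supremum once the whole space is known to have positive
   measure. *)
move=> T0; rewrite /Linfty_mx /finite_norm unlock T0 => Qoo.
have [M M0 QM] : exists2 M : R, 0 < M &
    (ess_sup mu (abse \o (EFin \o (fun x => opnorm (Q x)) \_ Omega)) <= M%:E)%E.
  move: Qoo; case: ess_sup => [r _| |]//; last by exists 1; rewrite ?leNye.
  by exists (`|r| + 1); [rewrite ltr_wpDl|rewrite lee_fin ler_wpDr// ler_norm].
exists (Num.sqrt (n.+1%:R * M)); first by rewrite sqrtr_gt0 mulr_gt0.
move/ess_supP : QM; apply: filterS => x /= Qx Ox v.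
have {}Qx : opnorm (Q x) <= M.
  by move: Qx; rewrite /patch mem_set// lee_fin; exact/le_trans/ler_norm.
rewrite -ler_sqr ?nnegrE ?enorm_ge0 ?mulr_ge0 ?sqrtr_ge0 ?enorm_ge0//.
have sE : Num.sqrt (n.+1%:R * M) ^+ 2 = n.+1%:R * M.
  by rewrite sqr_sqrtr// mulr_ge0// ltW.
rewrite (le_trans (enorm_sqrtmx_sqr_le _ _))// exprMn sE.
by rewrite ler_wpM2r ?sqr_ge0// ler_wpM2l.
Qed.

End sqrtmx_ae_bound.

Section energy_control.
Context (R : realType) (n : nat) (Theta : set 'rV[R]_n.+1).
Local Notation V := 'rV[R]_n.+1.
Local Notation mu := (lebesgueRn R n).
Variables (Q : V -> 'M[R]_n.+1) (p : R).
Implicit Types (U W : set V) (f : V -> R).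

(** A real upper bound [e] stands for the energy, so that all estimates involve real constants and
    infinite energy is dealt with once, at the end. *)
Definition energy_le f (e : R) : Prop :=
  0 <= e /\ (\int[mu]_(x in Theta) (`|Qgrad Q f x| `^ p)%:E <= e%:E)%E.

(** Used with (q, s) equal to (p, 1) and to (p sigma, sigma). In both cases q = p s, as homogeneity
    in f requires. *)
Definition controlled q s U : Prop := exists2 K : R, 0 < K &
  forall f e, Lip0 Theta f -> energy_le f e ->
  (\int[mu]_(x in U) (`|f x| `^ q)%:E <= (K * e `^ s)%:E)%E.

(** The gradient of f vanishes off [Theta], so a bound over [Theta] is a bound over any set. *)
Lemma energy_le_set f e U : 0 < p -> Lip0 Theta f -> energy_le f e ->
  (\int[mu]_(x in U) (`|Qgrad Q f x| `^ p)%:E <= e%:E)%E.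
Proof.
move=> p0 fL [_]; apply: le_trans; rewrite [leRHS]integral_mkcond.
apply: ge0_le_integral_subset => // x _.
  by rewrite /patch; case: ifP; rewrite // lee_fin powR_ge0.
rewrite /patch; case: ifPn => // /negP xT.
by rewrite (Qgrad_outside Q fL) ?normr0 ?powR0 ?gt_eqF// => /mem_set.
Qed.

Lemma controlled_subset q s U W : U `<=` W ->
  controlled q s W -> controlled q s U.
Proof.
move=> UW [K K0 HK]; exists K => // f e fL fe; apply: le_trans (HK _ _ fL fe).
exact: ge0_le_integral_subset.
Qed.

Lemma Lip0_measurable_powR f q U : Lip0 Theta f ->
  measurable_fun U (fun x => (`|f x| `^ q)%:E).
Proof.
move=> fL; apply/measurable_EFinP; apply: (measurableT_comp (measurable_powR q)).
apply: measurableT_comp => //; apply: continuous_measurable_Rn.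
exact: Lip0_continuous fL.
Qed.

Lemma controlledU q s U W : open U -> open W ->
  controlled q s U -> controlled q s W -> controlled q s (U `|` W).
Proof.
move=> oU oW [K K0 HK] [M M0 HM].
exists (K + M) => [|f e fL fe]; first exact: addr_gt0.
have [mU mW] := (open_measurable_Rn oU, open_measurable_Rn oW).
have mWU : measurable (~` U `&` W) by apply: measurableI => //; exact: measurableC.
have -> : U `|` W = U `|` (~` U `&` W) by rewrite setUIr setUv setTI.
rewrite (@ge0_integral_setU _ _ _ mu _ _ mU mWU _ (Lip0_measurable_powR _ fL))//; last first.
  by apply/disj_setPS => x [Ux [/(_ Ux)]].
rewrite mulrDl EFinD; apply: leeD; first exact: HK.
apply: le_trans (HM _ _ fL fe); exact: ge0_le_integral_subset.
Qed.

Lemma controlled0 q s : controlled q s set0.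
Proof.
by exists 1 => // f e _ _; rewrite integral_set0 lee_fin mul1r powR_ge0.
Qed.

(** Induction along a finite subcover; the partial unions stay open, as [controlledU] requires. *)
Lemma compact_controlled q s (A : set V) : compact A ->
  (forall y, A y -> exists U, [/\ open U, U y & controlled q s U]) ->
  controlled q s A.
Proof.
rewrite compact_cover => cA AU.
have /choice[U HU] : forall y, exists U, A y -> [/\ open U, U y & controlled q s U].
  move=> y; have [/AU[U HU]|Ay] := pselect (A y); first by exists U.
  by exists set0.
have [y /HU[]//|x Ax|D DA AD] := cA V A U.
  by exists x => //; have [] := HU _ Ax.
apply: controlled_subset AD _.
rewrite /cover bigcup_fset.
have : {subset finmap.enum_fset D <= A} by [].
elim: (finmap.enum_fset D) => [_|x r IH xrA].
  by rewrite big_nil; exact: controlled0.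
have Ax : A x by apply/set_mem/xrA; rewrite mem_head.
have rA : {subset r <= A} by move=> z zr; apply: xrA; rewrite inE zr orbT.
rewrite big_cons; have [oU _ cU] := HU x Ax; apply: controlledU => //; last exact: IH.
rewrite -bigcup_seq; apply: bigcup_open => z /= /rA/set_mem/HU[] //.
Qed.

Lemma controlled_disjoint q s U : 0 < q -> (forall x, U x -> ~ Theta x) ->
  controlled q s U.
Proof.
move=> q0 UT; exists 1 => // f e fL fe; rewrite integral0_eq.
  by rewrite lee_fin mul1r powR_ge0.
move=> x /UT xT; rewrite (nbhs_singleton (Lip0_outside fL xT)).
by rewrite normr0 powR0 ?gt_eqF.
Qed.

End energy_control.

(** * Propagation of the L^p bound through Omega by the Poincare inequality *)

Section control_of_functions.
Context (R : realType) (n : nat) (Omega Theta : set 'rV[R]_n.+1).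
Local Notation V := 'rV[R]_n.+1.
Local Notation mu := (lebesgueRn R n).
Variables (Q : V -> 'M[R]_n.+1) (r1 : V -> R) (p : R).
Hypotheses (Omega_open : open Omega) (p_gt0 : 0 < p).
Hypothesis r1_gt0 : forall y, Omega y -> 0 < r1 y.
Hypothesis Theta_sub : Theta `<=` Omega.
Hypothesis mu_open_gt0 : forall U : set V, open U -> U !=set0 -> (0 < mu U)%E.

Local Notation energy_le := (energy_le Theta Q p).
Local Notation controlled := (controlled Theta Q p).

Lemma open_bounded_mu (U : set V) : open U -> U !=set0 -> bounded_set U ->
  exists2 w : R, 0 < w & mu U = w%:E.
Proof.
move=> oU U0 bU; exists (fine (mu U)); last first.
  by rewrite fineK// ge0_fin_numE ?measure_ge0//; exact: bounded_lebesgueRn_lty.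
by rewrite fine_gt0// mu_open_gt0//=; exact: bounded_lebesgueRn_lty.
Qed.

(** This is the Poincare inequality raised to the power p, with m the mean of f over the ball. The
    radius and the constant depend on y but not on f. *)
Lemma poincare_oscillation y : local_poincare Omega Q r1 p -> Omega y ->
  exists r K : R, [/\ 0 < r, 0 <= K & forall f e, Lip0 Theta f -> energy_le f e ->
    exists m : R, (\int[mu]_(x in eball Omega y r) (`|f x - m| `^ p)%:E <=
                  (K * e)%:E)%E].
Proof.
move=> [C [b [C0 b1 poincare]]] Oy.
have b0 : 0 < b by rewrite (lt_le_trans _ b1).
have r1y := r1_gt0 Oy.
(* This makes b r = r1(y) / 2, which is admissible in the Poincare inequality. *)
pose r := r1 y / (2 * b); have r0 : 0 < r by rewrite divr_gt0// mulr_gt0.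
have br : 0 < b * r < r1 y.
  rewrite mulr_gt0//= (_ : b * r = r1 y / 2); first by lra.
  by rewrite /r; field; rewrite gt_eqF.
clearbody r.
pose B := eball Omega y r; pose B' := eball Omega y (b * r).
have oB : open B by exact: open_eball.
have By : B !=set0 by exists y; exact: eball_center.
have [w w0 muB] := open_bounded_mu oB By (bounded_eball _ _ _).
have B'0 := fine_lebesgueRn_ge0 B'.
exists r, (w * ((C * r) `^ p * (fine (mu B'))^-1)); split => //.
  by rewrite !mulr_ge0 ?powR_ge0 ?invr_ge0// ltW.
move=> f e fL fe; have [e0 _] := fe; exists (mean B f).
have Cr0 : 0 <= C * r by rewrite mulr_ge0 ?ltW.
have := poincare y r f Oy br (Lip0S Theta_sub fL); rewrite -/B -/B' => fB.
have {}fB : (Lpmean B p (fun x => f x - mean B f)%R <=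
    (C * r * ((fine (mu B'))^-1 * e) `^ p^-1)%:E)%E.
  apply: le_trans fB _; rewrite [leRHS]EFinM lee_wpmul2l ?lee_fin//.
  by apply: Lpmean_le => //; exact: energy_le_set fe.
have := Lpmean_ge p_gt0 _ _ fB; rewrite muB /= ltry lte_fin w0.
rewrite powRM ?powR_ge0// powR_invK ?gt_eqF//; last first.
  by rewrite mulr_ge0// invr_ge0.
rewrite !mulrA; apply=> //.
exact: mulr_ge0 Cr0 (powR_ge0 _ _).
Qed.

(** On [W], |m| <= |f - m| + |f|, which bounds |m|^p |W| by a multiple of e. Then |f| <= |f - m| +
    |m| carries the bound to all of [B], at the cost of the ratio |B| / |W|. *)
Lemma controlled_of_oscillation (B W : set V) K : open B -> bounded_set B ->
  open W -> W !=set0 -> W `<=` B -> 0 <= K ->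
  (forall f e, Lip0 Theta f -> energy_le f e ->
    exists m : R, (\int[mu]_(x in B) (`|f x - m| `^ p)%:E <= (K * e)%:E)%E) ->
  controlled p 1 W -> controlled p 1 B.
Proof.
move=> oB bB oW W0 WB K0 HK [M M0 HM].
have bW : bounded_set W.
  by case: bB => N [Nr BN]; exists N; split=> // N' NN x /WB; exact: BN.
have B0 : B !=set0 by have [x Wx] := W0; exists x; exact: WB.
have [w w0 muW] := open_bounded_mu oW W0 bW.
have [v v0 muB] := open_bounded_mu oB B0 bB.
pose c : R := (2 * 1) `^ p; have c0 : 0 < c by rewrite powR_gt0.
exists (c * K + c * (v / w * (c * K + c * M))).
  rewrite ltr_wpDl ?mulr_ge0 ?(ltW c0)//.
  rewrite mulr_gt0// mulr_gt0 ?divr_gt0// ltr_wpDl ?mulr_ge0 ?(ltW c0)//.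
  exact: mulr_gt0.
move=> f e fL fe; have [e0 _] := fe; rewrite powRr1//.
have [m fm] := HK f e fL fe.
have := HM f e fL fe; rewrite powRr1// => fW.
have mf D : measurable_fun D f.
  by apply: continuous_measurable_Rn; exact: Lip0_continuous fL.
have mW : `|m| `^ p * w <= c * (K * e) + c * (M * e).
  rewrite -lee_fin EFinM -muW -(integral_cst mu (open_measurable_Rn oW)) EFinD.
  apply: (le_trans (@integral_powR_le _ _ _ mu W (fun=> m) (fun x => f x - m) f
    p 1 1 (open_measurable_Rn oW) (ltW p_gt0) ltr01 ltr01 (mf _) _)).
    apply: aeW => x _; rewrite !mul1r distrC.
    by have := ler_normD (m - f x) (f x); rewrite subrK.
  rewrite !EFinM; apply: leeD; rewrite lee_wpmul2l ?lee_fin ?powR_ge0//.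
  by apply: le_trans fm; exact: ge0_le_integral_subset.
apply: (le_trans (@integral_powR_le _ _ _ mu B f (fun x => f x - m) (fun=> m)
  p 1 1 (open_measurable_Rn oB) (ltW p_gt0) ltr01 ltr01 _ _)) => //.
  apply: aeW => x _; rewrite !mul1r.
  by have := ler_normD (f x - m) m; rewrite subrK.
have -> : (\int[mu]_(x in B) (`|m| `^ p)%:E = (`|m| `^ p)%:E * v%:E)%E.
  by rewrite -muB -(integral_cst mu (open_measurable_Rn oB)).
rewrite -/c.
apply: (@le_trans _ _ (c%:E * (K * e)%:E + c%:E * ((`|m| `^ p)%:E * v%:E))%E).
  by rewrite leeD2r// lee_wpmul2l// lee_fin ltW.
rewrite -!EFinM -EFinD lee_fin mulrDl -!mulrA lerD2l ler_wpM2l ?(ltW c0)//.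
rewrite mulrC ler_wpM2l ?(ltW v0)// -ler_pdivrMl ?invr_gt0// invrK mulrC.
by rewrite (le_trans mW)// mulrDl !mulrA.
Qed.

Lemma controlled_near : connected Omega -> local_poincare Omega Q r1 p ->
  (exists y, Omega y /\ ~ closure Theta y) -> forall y, Omega y ->
  exists U, [/\ open U, U y & controlled p 1 U].
Proof.
move=> cO poincare [y0 [Oy0 Ty0]].
pose P y := exists U, [/\ open U, U y & controlled p 1 U].
have oP : open [set y | P y].
  rewrite openE => y [U [oU Uy cU]]; rewrite /interior.
  have : nbhs y U by exact: open_nbhs_nbhs.
  by apply: filterS => z Uz; exists U.
suff <- : Omega `&` [set y | P y] = Omega by move=> y [].
(* Connectedness asks that the set of good points be nonempty, open in Omega and closed in Omega, in
   this order. *)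
apply: cO.
- exists y0; split => //; exists (~` closure Theta); split => //.
    exact/closed_openC/closed_closure.
  by apply: controlled_disjoint => // x Tx /subset_closure.
- by exists [set y | P y].
exists (closure [set y | P y]); first exact: closed_closure.
apply/seteqP; split => y [Oy Py]; split => //; first exact: subset_closure.
have [r [K [r0 K0 HK]]] := poincare_oscillation poincare Oy.
pose B := eball Omega y r; have oB : open B by exact: open_eball.
have By : B y by exact: eball_center.
exists B; split=> //.
(* As y is in the closure of the good points, the ball [B] contains one of them. The bound then
   spreads from the intersection of its neighbourhood [U] with [B] to the whole of [B]. *)
have [z [[U [oU Uz cU]] Bz]] := Py B (open_nbhs_nbhs (conj oB By)).
apply: (@controlled_of_oscillation B (U `&` B) K) => //.
- exact: bounded_eball.
- exact: openI.
- by exists z.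
exact: controlled_subset cU.
Qed.

End control_of_functions.

(** * Local gain of integrability by the Sobolev inequality *)

Section sobolev_step.
Context (R : realType) (n : nat) (Omega Theta : set 'rV[R]_n.+1).
Local Notation V := 'rV[R]_n.+1.
Local Notation mu := (lebesgueRn R n).
Variables (Q : V -> 'M[R]_n.+1) (r1 : V -> R) (p sigma : R).
Hypotheses (Omega_open : open Omega) (p_gt0 : 0 < p) (sigma_gt0 : 0 < sigma).
Hypothesis r1_gt0 : forall y, Omega y -> 0 < r1 y.
Hypothesis mu_open_gt0 : forall U : set V, open U -> U !=set0 -> (0 < mu U)%E.
Variable L : R.
Hypothesis L_gt0 : 0 < L.
Hypothesis sqrtQ_le : {ae mu, forall x, Omega x ->
  forall v : 'cV_n.+1, enorm (sqrtmx (Q x) *m v) <= L * enorm v}.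

(** The Sobolev inequality is applied to g = f * cutoff on the ball of radius 2t inside [U]. The
    cutoff is at least 1 on the ball of radius t, so |f| <= |g| there. *)
Lemma sobolev_controlled_near y (U : set V) :
  local_sobolev Omega Q r1 p sigma -> Omega y ->
  open U -> U y -> controlled Theta Q p p 1 U ->
  exists W, [/\ open W, W y & controlled Theta Q p (p * sigma) sigma W].
Proof.
move=> [C0 C00 sobolev] Oy oU Uy [K K0 HK].
have /nbhs_rVP[e0 e00 eOU] : nbhs y (Omega `&` U).
  by apply: open_nbhs_nbhs; split=> //; exact: openI.
(* The Euclidean ball of radius 2t < e0 lies in the max-norm ball of radius e0, hence in Omega and
   [U]; 2t < r1(y) is what the Sobolev property asks. *)
have [t [t0 te tr]] : exists t, [/\ 0 < t, 2 * t < e0 & 2 * t < r1 y].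
  have := r1_gt0 Oy; exists (Num.min e0 (r1 y) / 4).
  by split; case: (leP e0 (r1 y)) => ?; lra.
pose B := eball Omega y (2 * t).
have near_y x : enorm (x - y) < 2 * t -> (Omega `&` U) x.
  move=> xy; apply: eOU => i; rewrite distrC.
  have := ler_coord_enorm (x - y) 0 i; rewrite !mxE; lra.
have BU : B `<=` U by move=> x [_ /near_y[]].
have CB : [set x | enorm (x - y) ^+ 2 <= 2 * t ^+ 2] `<=` B.
  move=> x /= xt; have xy : enorm (x - y) < 2 * t.
    rewrite -ltr_sqr ?nnegrE ?enorm_ge0 ?mulr_ge0 ?(ltW t0)//.
    by apply: le_lt_trans xt _; nra.
  by split=> //; have [] := near_y _ xy.
have oB : open B by exact: open_eball.
have mB := open_measurable_Rn oB.
have By : B !=set0 by exists y; apply: eball_center => //; rewrite mulr_gt0.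
have [w w0 muB] := open_bounded_mu mu_open_gt0 oB By (bounded_eball _ _ _).
(* The coefficient of |f| in [Qgrad_mul_cutoff_le], plus 1 to make it positive. *)
pose l := 2 * (L * (n.+1%:R * cutoff_lip n t)) + 1.
have l0 : 0 < l.
  rewrite /l ltr_wpDl// mulr_ge0// mulr_ge0 ?(ltW L_gt0)// mulr_ge0//.
  exact: cutoff_lip_ge0.
(* [K2 * e] will bound the integral of |sqrt(Q) grad g|^p, and [K3 * e] that of |g|^p, the latter
   from |g| <= 2 |f| + 2 |f|. *)
pose K2 := (2 * 8) `^ p + (2 * l) `^ p * K.
pose K3 := (2 * 2) `^ p * K + (2 * 2) `^ p * K.
have [K20 K30] : 0 < K2 /\ 0 < K3.
  by split; rewrite addr_gt0 ?mulr_gt0// powR_gt0// mulr_gt0.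
(* With these bounds the right-hand side of the Sobolev inequality for g is at most a e^(1/p). *)
pose a := C0 * (2 * t) * (w^-1 * K2) `^ p^-1 + C0 * (w^-1 * K3) `^ p^-1.
have a0 : 0 < a.
  by rewrite addr_gt0// !mulr_gt0// powR_gt0// mulr_gt0// invr_gt0.
have ps0 : 0 < p * sigma by exact: mulr_gt0.
exists (eball Omega y t); split; [exact: open_eball|exact: eball_center|].
exists (w * a `^ (p * sigma)); first by rewrite mulr_gt0// powR_gt0.
move=> f e fL fe; have [e_ge0 _] := fe.
pose g x := f x * cutoff y t x.
have gL : Lip0 B g by exact: Lip0_mul_cutoff fL CB.
have mf : measurable_fun B f.
  by apply: continuous_measurable_Rn; exact: Lip0_continuous fL.
have fK : (\int[mu]_(x in B) (`|f x| `^ p)%:E <= (K * e)%:E)%E.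
  have := HK f e fL fe; rewrite powRr1// => /(le_trans _); apply.
  exact: ge0_le_integral_subset.
have gK : (\int[mu]_(x in B) (`|g x| `^ p)%:E <= (K3 * e)%:E)%E.
  apply: (le_trans (@integral_powR_le _ _ _ mu B g f f p 2 2 mB
    (ltW p_gt0) _ _ mf _)) => //.
    apply: aeW => x _; rewrite /g normrM (ger0_norm (cutoff_ge0 _ _ _)).
    by have := cutoff_le4 y t x; have := normr_ge0 (f x); nra.
  rewrite (_ : K3 * e = (2 * 2) `^ p * (K * e) + (2 * 2) `^ p * (K * e)); last first.
    by rewrite /K3; ring.
  rewrite EFinD !(EFinM (_ `^ _)).
  by apply: leeD; rewrite lee_wpmul2l// lee_fin powR_ge0.
have QgK : (\int[mu]_(x in B) (`|Qgrad Q g x| `^ p)%:E <= (K2 * e)%:E)%E.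
  have [D D0 fD] := Lip0_bounded fL.
  apply: (le_trans (@integral_powR_le _ _ _ mu B _ (Qgrad Q f) f p 8 l mB
    (ltW p_gt0) _ _ mf _)) => //.
    apply: filterS sqrtQ_le => x Qx [Ox _].
    rewrite !(ger0_norm (enorm_ge0 _)) (le_trans (Qgrad_mul_cutoff_le y t0 fD (Qx Ox)))//.
    by rewrite lerD2l ler_wpM2r// lerDl.
  rewrite (_ : K2 * e = (2 * 8) `^ p * e + (2 * l) `^ p * (K * e)); last first.
    by rewrite /K2; ring.
  rewrite EFinD !(EFinM (_ `^ _)).
  apply: leeD; rewrite lee_wpmul2l// ?lee_fin ?powR_ge0//.
  exact: energy_le_set fe.
have Lg : (Lpmean B (p * sigma) g <= (a * e `^ p^-1)%:E)%E.
  have rt : 0 < 2 * t < r1 y by rewrite mulr_gt0.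
  apply: le_trans (sobolev y (2 * t) g Oy rt gL) _.
  have Lp k : 0 < k -> ((fine (mu B))^-1 * (k * e)) `^ p^-1 =
      (w^-1 * k) `^ p^-1 * e `^ p^-1.
    by move=> k0; rewrite muB /= mulrA powRM// mulr_ge0 ?invr_ge0 ?ltW.
  pose A k := ((fine (mu B))^-1 * (k * e)) `^ p^-1.
  have -> : (a * e `^ p^-1)%:E =
      ((C0 * (2 * t))%:E * (A K2)%:E + C0%:E * (A K3)%:E)%E.
    rewrite -!EFinM -EFinD; congr (_%:E); rewrite /A (Lp _ K20) (Lp _ K30).
    by rewrite [LHS]mulrDl; congr (_ + _); rewrite -[LHS]mulrA.
  have Ct0 : 0 <= C0 * (2 * t) by rewrite mulr_ge0 ?(ltW C00) ?mulr_ge0 ?(ltW t0).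
  apply: leeD; apply: lee_wpmul2l; rewrite ?lee_fin ?(ltW C00)//.
    exact: Lpmean_le.
  exact: Lpmean_le.
(* Raising to the power p sigma turns e^(1/p) into e^sigma, the exponent in [controlled]. *)
have aE : (a * e `^ p^-1) `^ (p * sigma) = a `^ (p * sigma) * e `^ sigma.
  by rewrite powRM ?powR_ge0 ?(ltW a0)// (powRrM (e `^ _)) powR_invK// gt_eqF.
have := Lpmean_ge ps0 _ _ Lg; rewrite muB lte_fin w0 ltry aE mulrA => {}Lg.
apply: le_trans (Lg _ _); rewrite ?mulr_ge0 ?powR_ge0 ?(ltW a0)//.
apply: ge0_le_integral_subset => // x.
  move=> [Ox xt]; split=> //; apply: lt_trans xt _; lra.
move=> [Ox /ltW/cutoff_ge1 b1]; rewrite lee_fin ge0_ler_powR ?nnegrE ?(ltW ps0)//.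
rewrite /g normrM ler_peMr// ger0_norm ?cutoff_ge0//; exact: b1.
Qed.

End sobolev_step.

(** * Compactness in R^n *)

Section compact_containment.
Context (R : realType) (n : nat).
Implicit Types A U : set 'rV[R]_n.+1.

Lemma compactly_contained_compact A U : compactly_contained A U ->
  compact (closure A).
Proof.
move=> [[M [_ AM]] _]; apply: bounded_closed_compact; last exact: closed_closure.
apply: (@bounded_set_norm_le _ _ _ (M + 1)) => x Ax.
have : closed [set x : 'rV[R]_n.+1 | `|x| <= M + 1].
  apply: (@preimage_closed _ _ (fun x : 'rV[R]_n.+1 => `|x|) [set s | s <= M + 1]).
    by move=> z _; exact: norm_continuous.
  exact: closed_le.
move=> /closure_id H.
rewrite -[is_true _]/([set x : 'rV[R]_n.+1 | `|x| <= M + 1] x) H.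
by move: x Ax; apply: closure_subset => z /AM; apply; rewrite ltrDl.
Qed.

(** On a nonempty compact set the first coordinate attains a maximum, whereas in an open set it can
    always be increased a little. *)
Lemma open_not_compact U : open U -> U !=set0 -> ~ compact U.
Proof.
move=> oU U0 cU.
have [x Ux xmax] := @EVT_max_rV R n.+1 (fun x => x 0 0) U U0 cU
  (continuous_subspaceT (@coord_continuous R 1 n.+1 0 0)).
have /nbhs_rVP[e e0 eU] := open_nbhs_nbhs (conj oU (set_mem Ux)).
pose z := set_coord x 0 (x 0 0 + e / 2).
have Uz : U z.
  apply: eU => i; rewrite mxE; case: eqP => [->|_]; last by rewrite subrr normr0.
  by rewrite opprD addNKr normrN gtr0_norm; lra.
by have := xmax z (mem_set Uz); rewrite mxE eqxx; lra.
Qed.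

End compact_containment.

Theorem theorem1p2 (R : realType) (n : nat) (Omega : set 'rV[R]_n.+1)
    (p sigma : R) (Q : 'rV[R]_n.+1 -> 'M[R]_n.+1) (r1 : 'rV[R]_n.+1 -> R)
    (Omega_open : open Omega) (Omega_connected : connected Omega)
    (p_gt1 : 1 < p) (sigma_gt1 : 1 < sigma)
    (Q_measurable : measurable_mx Omega Q) (Q_psd : ae_sym_psd Omega Q)
    (Q_bounded : Linfty_mx Omega Q)
    (r1_continuous : {within Omega, continuous r1})
    (r1_gt0 : forall y, Omega y -> 0 < r1 y)
    (sobolev : local_sobolev Omega Q r1 p sigma)
    (poincare : local_poincare Omega Q r1 p)
    (Theta : set 'rV[R]_n.+1) (Theta_open : open Theta)
    (Theta_sub : compactly_contained Theta Omega) :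
  exists C : R, forall f : 'rV[R]_n.+1 -> R, Lip0 Theta f ->
    (Lpnorm Theta (p * sigma) f <= C%:E * Lpnorm Theta p (Qgrad Q f))%E.
Proof.
have p0 : 0 < p by lra.
have sigma0 : 0 < sigma by lra.
have ps0 : 0 < p * sigma by rewrite mulr_gt0.
pose mu := lebesgueRn R n.
(* A nonempty open set could be null only if the whole space were; in that
   (impossible) case the left-hand side is 0, so positivity need not be proved. *)
have [T0|TN0] := eqVneq (mu setT) 0%E.
  exists 0 => f _; rewrite mul0e /Lpnorm (_ : integral _ _ _ = 0%E).
    by rewrite poweR0r// invr_eq0 gt_eqF.
  apply/eqP; rewrite eq_le integral_powR_ge0 andbT.
  rewrite -[leRHS](integral0 mu Theta).
  apply: ge0_ae_le_integral => //; first exact: open_measurable_Rn.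
  by exists setT; split => //; exact: open_measurable_Rn openT.
have mu_open_gt0 (U : set 'rV[R]_n.+1) : open U -> U !=set0 -> (0 < mu U)%E.
  move=> oU U0; rewrite lt_neqAle measure_ge0 andbT eq_sym.
  by apply: contra TN0 => /eqP /(null_open_lebesgueRnT oU U0)/eqP.
have [L L0 sqrtQ_le] : exists2 L : R, 0 < L & {ae mu, forall x, Omega x ->
    forall v : 'cV_n.+1, enorm (sqrtmx (Q x) *m v) <= L * enorm v}.
  apply: Linfty_sqrtmx_bound Q_bounded; apply: mu_open_gt0; first exact: openT.
  by exists 0.
have [_ ThO] := Theta_sub.
have cTheta := compactly_contained_compact Theta_sub.
(* Otherwise Omega would equal closure(Theta), which is compact. Such a point starts the
   connectedness argument. *)
have outside : Omega !=set0 -> exists y, Omega y /\ ~ closure Theta y.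
  move=> O0; apply: contrapT => noy; apply: (open_not_compact Omega_open O0).
  rewrite (_ : Omega = closure Theta)//; apply/seteqP; split=> // y Oy.
  by apply: contrapT => Ty; apply: noy; exists y.
have [K K0 HK] : controlled Theta Q p (p * sigma) sigma (closure Theta).
  apply: compact_controlled cTheta _ => y /ThO Oy.
  have [|U [oU Uy cU]] := controlled_near Omega_open p0 r1_gt0
    (subset_trans (@subset_closure _ Theta) ThO) mu_open_gt0 Omega_connected
    poincare _ Oy.
    by apply: outside; exists y.
  exact: sobolev_controlled_near sqrtQ_le _ _ sobolev Oy oU Uy cU.
(* The power 1 / (p sigma) of K e^sigma is K^(1/(p sigma)) e^(1/p). *)
exists (K `^ (p * sigma)^-1) => f fL.
have C0 : 0 < K `^ (p * sigma)^-1 by rewrite powR_gt0.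
rewrite /Lpnorm; have := integral_powR_ge0 Theta p (Qgrad Q f).
case E : (integral _ _ _) => [e| |]// e0; last first.
  (* If the energy is infinite, so is the right-hand side, since the constant is positive. *)
  by rewrite poweRyr ?invr_eq0 ?gt_eqF// gt0_muley ?lte_fin// leey.
have fe : energy_le Theta Q p f e by split; [rewrite -lee_fin|rewrite E].
have fK : (\int[mu]_(x in Theta) (`|f x| `^ (p * sigma))%:E <= (K * e `^ sigma)%:E)%E.
  apply: le_trans (HK f e fL fe); apply: ge0_le_integral_subset => //.
  exact: subset_closure.
have -> : ((K `^ (p * sigma)^-1)%:E * e%:E `^ p^-1 =
    (K * e `^ sigma)%:E `^ (p * sigma)^-1)%E.
  rewrite !poweR_EFin -EFinM powRM ?powR_ge0 ?ltW// -powRrM.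
  by rewrite invfM mulrCA mulfV ?mulr1 ?gt_eqF.
apply: gt0_ler_poweR => //.
- by rewrite invr_ge0 ltW.
- by rewrite in_itv/= leey andbT integral_powR_ge0.
- by rewrite in_itv/= leey andbT lee_fin mulr_ge0 ?powR_ge0// ltW.
Qed.
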